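(* Let $X$ be a semi-locally simply connected Peano continuum and let $N\subset\pi_1(X)$ be a normal subgroup. If the covering map of $X$ corresponding to $N$ is (equivalent to) an entourage cover, then $N$ is the normal closure of a finite set.
   Context: A Peano continuum is a compact, connected, locally path connected metrizable space. The covering map corresponding to a normal subgroup $N\subset\pi_1(X)$ is the regular covering $\widetilde X/N\to X$, where $\widetilde X$ is the universal cover (the image of its fundamental group in $\pi_1(X)$ is $N$). The normal closure of a subset of a group is the smallest normal subgroup containing it. An entourage in the compact space $X$ is a symmetric subset of $X\times X$ containing an open set that contains the diagonal. $B(x,E):=\{y:(x,y)\in E\}$. An $E$-chain is a finite sequence $\{x_0,\dots,x_n\}$ with $(x_i,x_{i+1})\in E$ for all $i$. An $E$-homotopy between $E$-chains is a finite sequence of $E$-chains with the same endpoints, each obtained from the previous one by inserting or removing a single point (never an endpoint), every step remaining an $E$-chain; $[\alpha]_E$ is the $E$-homotopy class of $\alpha$ (a chain $\{x,x\}$ is identified with $\{x\}$). Concatenation is $\ast$, reversal is $\overline{\alpha}$. $E$ is chained if $E$ is contained in the closure of its interior and whenever $(x,y)\in E$ and $F$ is an entourage, $x,y$ can be joined by an $F$-chain lying in $B(x,E)\cap B(y,E)$. Fix a basepoint $\ast\in X$. $X_E$ is the set of classes $[\alpha]_E$ of $E$-chains starting at $\ast$, and $\phi_E:X_E\to X$ sends $[\alpha]_E$ to the endpoint of $\alpha$. For an entourage $F\subset E$, $F^\ast$ is the set of pairs $([\alpha]_E,[\beta]_E)$ with endpoints $x,y$ such that $(x,y)\in F$ and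 $[\overline{\alpha}\ast\beta]_E=[\{x,y\}]_E$; the balls $B(\cdot,F^\ast)$ form a basis of the topology of $X_E$, for which $\phi_E$ is a regular covering map. An entourage cover is a $\phi_E$ with $E$ chained. Two covers of $X$ are equivalent if there is a homeomorphism between the total spaces commuting with the projections to $X$. *)

(* Defs.v *)
From HB Require Import structures.
From Stdlib Require Import Relation_Operators.
From mathcomp Require Import all_boot all_order all_algebra.
From mathcomp Require Import generic_quotient.
From mathcomp Require Import all_classical all_reals all_analysis.
From mathcomp Require Import homotopy lra.

Set Implicit Arguments.
Unset Strict Implicit.
Unset Printing Implicit Defensive.

Import Order.TTheory GRing.Theory Num.Theory.
Import numFieldNormedType.Exports.

Local Open Scope classical_set_scope.
Local Open Scope ring_scope.
Local Open Scope quotient_scope.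

Definition unit_interval (R : realType) : Type := set_type `[0 : R, 1]%classic.

HB.instance Definition _ (R : realType) :=
  Topological.copy (unit_interval R) (set_type `[0 : R, 1]%classic).

Section unit_interval.
Context {R : realType}.
Local Notation I := (unit_interval R).

Definition uval (t : I) : R := set_val t.

Lemma uval_itv (t : I) : 0 <= uval t <= 1.
Proof. by have := set_valP t; rewrite /= in_itv. Qed.

Lemma uval_inj : injective uval.
Proof. exact: val_inj. Qed.

Lemma clip_subproof (r : R) :
  Num.max 0 (Num.min 1 r) \in (`[0 : R, 1]%classic : set R).
Proof.
by apply/mem_set; rewrite /= in_itv /= le_max lexx ge_max ler01 ge_min lexx.
Qed.

Definition clip (r : R) : I := SigSub (clip_subproof r).

Lemma uval_clip (r : R) : uval (clip r) = Num.max 0 (Num.min 1 r).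
Proof. by []. Qed.

Lemma uvalK : cancel uval clip.
Proof.
move=> t; apply: uval_inj; rewrite uval_clip.
by have /andP[t0 t1] := uval_itv t; rewrite min_r// max_r.
Qed.

Lemma clipK (r : R) : 0 <= r <= 1 -> uval (clip r) = r.
Proof. by move=> /andP[r0 r1]; rewrite uval_clip min_r// max_r. Qed.

Lemma uval_continuous : continuous uval.
Proof. exact: initial_continuous. Qed.

Lemma clip_continuous : continuous clip.
Proof.
apply: continuous_comp_initial => r /=.
apply: (@continuous_max R R (cst 0) (fun s => Num.min 1 s)).
  exact: cst_continuous.
apply: (@continuous_min R R (cst 1) id); first exact: cst_continuous.
exact: cvg_id.
Qed.

Lemma clip01_subproof : clip 0 != clip 1 :> I.
Proof.
apply/eqP => /(congr1 uval); rewrite !clipK ?lexx ?ler01// => /eqP.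
by rewrite eq_sym oner_eq0.
Qed.

End unit_interval.

HB.instance Definition _ (R : realType) :=
  isBiPointed.Build (unit_interval R) (@clip01_subproof R).

Section paste.
Context {R : realType} {T X : topologicalType}.

Lemma paste_continuous (u : T -> R) (c : R) (f g : T -> X) :
  continuous u -> continuous f -> continuous g ->
  (forall t, u t = c -> f t = g t) ->
  continuous (fun t => if u t <= c then f t else g t).
Proof.
move=> cu cf cg fg t W; set h := fun s => _; rewrite /h.
have [utc|ctu|utc] := ltgtP (u t) c => hW;
  apply: (@filterS _ (nbhs t) _ [set s | W (h s)]) => //; rewrite /h.
- have N : nbhs t (u @^-1` [set r | r < c]) := cu t _ (lt_nbhsl utc).
  have fW : nbhs t (f @^-1` W) := cf t _ hW.
  by apply: filterS2 N fW => s /= usc; rewrite ltW.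
- have N : nbhs t (u @^-1` [set r | c < r]) by apply: cu; exact: lt_nbhsr.
  have gW : nbhs t (g @^-1` W) := cg t _ hW.
  by apply: filterS2 N gW => s /= usc; rewrite leNgt usc.
- have fW : nbhs t (f @^-1` W) := cf t _ hW.
  have gW : nbhs t (g @^-1` W) by apply: cg; rewrite -fg.
  by apply: filterS2 fW gW => s /=; case: ifP.
Qed.

End paste.

Section path_homotopy.
Context {R : realType} {X : topologicalType}.
Local Notation I := (unit_interval R).
Implicit Types f g h : I -> X.

(* Homotopy relative to the endpoints, stated for maps on the interval so that
   the endpoints need not agree judgmentally; the clauses force them to agree
   (path_homotopic_ends). *)
Definition path_homotopic f g := exists H : I * I -> X,
  [/\ continuous H,
      forall s, H (s, zero) = f s,
      forall s, H (s, one) = g s,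
      forall t, H (zero, t) = f zero &
      forall t, H (one, t) = f one].

Lemma uval0 : uval (zero : I) = 0.
Proof. by rewrite clipK ?lexx ?ler01. Qed.

Lemma uval1 : uval (one : I) = 1.
Proof. by rewrite clipK ?lexx ?ler01. Qed.

Lemma clip_le0 (r : R) : r <= 0 -> clip r = zero :> I.
Proof.
move=> r0; apply: uval_inj; rewrite uval0 uval_clip min_r ?max_l//.
exact: le_trans r0 ler01.
Qed.

Lemma clip_ge1 (r : R) : 1 <= r -> clip r = one :> I.
Proof. by move=> r1; apply: uval_inj; rewrite uval1 uval_clip min_l ?max_r. Qed.

Lemma path_homotopic_refl f : continuous f -> path_homotopic f f.
Proof.
by move=> cf; exists (f \o fst); split=> // -[s t]; apply: continuous_comp;
  [exact: cvg_fst|exact: cf].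
Qed.

Lemma path_homotopic_ends f g :
  path_homotopic f g -> f zero = g zero /\ f one = g one.
Proof. by move=> [H [_ _ H1 Hz Ho]]; rewrite -!H1 Hz Ho. Qed.

Let clip_comp_continuous (T : topologicalType) (u : T -> R) :
  continuous u -> continuous (clip \o u : T -> I).
Proof.
by move=> cu t; apply: continuous_comp; [exact: cu|exact: clip_continuous].
Qed.

Let pair_continuous (T U V : topologicalType) (u : T -> U) (v : T -> V) :
  continuous u -> continuous v -> continuous (fun t => (u t, v t)).
Proof. by move=> cu cv t; apply: cvg_pair; [exact: cu|exact: cv]. Qed.

Let comp_continuous (T U V : topologicalType) (u : T -> U) (v : U -> V) :
  continuous u -> continuous v -> continuous (v \o u).
Proof. by move=> cu cv t; apply: continuous_comp; [exact: cu|exact: cv]. Qed.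

Lemma affine_continuous (T : topologicalType) (u : T -> R) (a b : R) :
  continuous u -> continuous (fun t => a * u t + b).
Proof.
move=> cu t; apply: cvgD; last exact: cvg_cst.
by apply: cvgM; [exact: cvg_cst|exact: cu].
Qed.

Let ufst_continuous : continuous (fun z : I * I => uval z.1).
Proof. by apply: comp_continuous uval_continuous => -[s t]; exact: cvg_fst. Qed.

Let usnd_continuous : continuous (fun z : I * I => uval z.2).
Proof. by apply: comp_continuous uval_continuous => -[s t]; exact: cvg_snd. Qed.

Lemma path_homotopic_sym f g : path_homotopic f g -> path_homotopic g f.
Proof.
move=> fg; have [fg0 fg1] := path_homotopic_ends fg.
have [H [cH H0 H1 Hz Ho]] := fg.
exists (fun z => H (z.1, clip (- 1 * uval z.2 + 1))); split.
- apply: comp_continuous cH; apply: pair_continuous.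
    by move=> -[s t]; exact: cvg_fst.
  exact/clip_comp_continuous/affine_continuous/usnd_continuous.
- by move=> s /=; rewrite uval0 mulr0 add0r H1.
- by move=> s /=; rewrite uval1 mulr1 addNr H0.
- by move=> t /=; rewrite Hz.
- by move=> t /=; rewrite Ho.
Qed.

Lemma path_homotopic_trans f g h :
  path_homotopic f g -> path_homotopic g h -> path_homotopic f h.
Proof.
move=> fg; have [fg0 fg1] := path_homotopic_ends fg.
have [H [cH H0 H1 Hz Ho]] := fg => -[K [cK K0 K1 Kz Ko]].
exists (fun z => if uval z.2 <= 2^-1 then H (z.1, clip (2 * uval z.2 + 0))
                 else K (z.1, clip (2 * uval z.2 - 1))); split.
- apply: (@paste_continuous R).
  + exact: usnd_continuous.
  + apply: comp_continuous cH; apply: pair_continuous.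
      by move=> -[s t]; exact: cvg_fst.
    exact/clip_comp_continuous/affine_continuous/usnd_continuous.
  + apply: comp_continuous cK; apply: pair_continuous.
      by move=> -[s t]; exact: cvg_fst.
    exact/clip_comp_continuous/affine_continuous/usnd_continuous.
  + move=> -[s t] /= ->; rewrite clip_ge1; last by lra.
    by rewrite clip_le0 ?H1 ?K0//; lra.
- by move=> s /=; rewrite uval0 invr_ge0 ler0n clip_le0 ?H0//; lra.
- move=> s /=; rewrite uval1 ifF; last by apply/negbTE; rewrite -ltNge; lra.
  by rewrite clip_ge1 ?K1//; lra.
- by move=> t /=; case: ifP; rewrite ?Hz ?Kz.
- by move=> t /=; case: ifP; rewrite ?Ho ?Ko.
Qed.

Lemma path_homotopic_reparam f (phi psi : I -> R) : continuous f ->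
  continuous phi -> continuous psi -> phi zero = psi zero ->
  phi one = psi one -> path_homotopic (f \o clip \o phi) (f \o clip \o psi).
Proof.
move=> cf cphi cpsi e0 e1.
pose h (z : I * I) := (1 - uval z.2) * phi z.1 + uval z.2 * psi z.1.
exists (f \o clip \o h); split => /=.
- apply: comp_continuous; last first.
    by apply: comp_continuous cf; exact: clip_continuous.
  have cfst : continuous (fst : I * I -> I) by move=> -[s t]; exact: cvg_fst.
  move=> z; apply: cvgD; apply: cvgM.
  + by apply: cvgB; [exact: cvg_cst|exact: usnd_continuous].
  + exact: (comp_continuous cfst cphi).
  + exact: usnd_continuous.
  + exact: (comp_continuous cfst cpsi).
- by move=> s; rewrite /h /= uval0 subr0 mul1r mul0r addr0.
- by move=> s; rewrite /h /= uval1 subrr mul1r mul0r add0r.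
- by move=> t; rewrite /h /= e0 -mulrDl subrK mul1r.
- by move=> t; rewrite /h /= e1 -mulrDl subrK mul1r.
Qed.

Section concatenation.
Context {x y z : X}.
Variables (p : {path I from x to y}) (q : {path I from y to z}).

Definition path_cat_fun (t : I) : X :=
  if uval t <= 2^-1 then p (clip (2 * uval t + 0))
  else q (clip (2 * uval t - 1)).

Lemma path_cat_continuous : continuous path_cat_fun.
Proof.
apply: (@paste_continuous R).
- exact: uval_continuous.
- apply: comp_continuous; last exact: cts_fun.
  exact/clip_comp_continuous/affine_continuous/uval_continuous.
- apply: comp_continuous; last exact: cts_fun.
  exact/clip_comp_continuous/affine_continuous/uval_continuous.
- move=> t /= ->; rewrite clip_ge1; last by lra.
  by rewrite clip_le0 ?path_zero ?path_one//; lra.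
Qed.

Lemma path_cat_zero : path_cat_fun zero = x.
Proof.
by rewrite /path_cat_fun uval0 invr_ge0 ler0n clip_le0 ?path_zero//; lra.
Qed.

Lemma path_cat_one : path_cat_fun one = z.
Proof.
rewrite /path_cat_fun uval1 ifF; last by apply/negbTE; rewrite -ltNge; lra.
by rewrite clip_ge1 ?path_one//; lra.
Qed.

Definition path_cat : {path I from x to z} :=
  mk_path path_cat_continuous path_cat_zero path_cat_one.

Definition path_rev_fun (t : I) : X := p (clip (1 - uval t)).

Lemma path_rev_continuous : continuous path_rev_fun.
Proof.
have c : continuous (fun t : I => 1 - uval t).
  rewrite (_ : (fun t => _) = (fun t => -1 * uval t + 1)).
    exact/affine_continuous/uval_continuous.
  by apply/funext => t; rewrite mulN1r addrC.
exact: comp_continuous (clip_comp_continuous c) (@cts_fun _ _ p).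
Qed.

Lemma path_rev_zero : path_rev_fun zero = y.
Proof. by rewrite /path_rev_fun uval0 subr0 path_one. Qed.

Lemma path_rev_one : path_rev_fun one = x.
Proof. by rewrite /path_rev_fun uval1 subrr path_zero. Qed.

Definition path_rev : {path I from y to x} :=
  mk_path path_rev_continuous path_rev_zero path_rev_one.

Lemma path_catE (t : I) : path_cat t =
  if uval t <= 2^-1 then p (clip (2 * uval t + 0))
  else q (clip (2 * uval t - 1)).
Proof. by []. Qed.

Lemma path_revE (t : I) : path_rev t = p (clip (1 - uval t)).
Proof. by []. Qed.

End concatenation.

Definition path_cst (x : X) : {path I from x to x} := cst x.

Lemma path_cat_homotopic (x y z x' y' z' : X)
    (p : {path I from x to y}) (q : {path I from y to z})
    (p' : {path I from x' to y'}) (q' : {path I from y' to z'}) :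
  path_homotopic p p' -> path_homotopic q q' ->
  path_homotopic (path_cat p q) (path_cat p' q').
Proof.
move=> [H [cH H0 H1 Hz Ho]] [K [cK K0 K1 Kz Ko]].
exists (fun w => if uval w.1 <= 2^-1 then H (clip (2 * uval w.1 + 0), w.2)
                 else K (clip (2 * uval w.1 - 1), w.2)); split.
- apply: (@paste_continuous R).
  + exact: ufst_continuous.
  + apply: comp_continuous cH; apply: pair_continuous.
      exact/clip_comp_continuous/affine_continuous/ufst_continuous.
    by move=> -[s t]; exact: cvg_snd.
  + apply: comp_continuous cK; apply: pair_continuous.
      exact/clip_comp_continuous/affine_continuous/ufst_continuous.
    by move=> -[s t]; exact: cvg_snd.
  + move=> -[s t] /= ->; rewrite clip_ge1; last by lra.
    by rewrite clip_le0 ?Ho ?Kz ?path_zero ?path_one//; lra.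
- by move=> s /=; rewrite /path_cat_fun H0 K0.
- by move=> s /=; rewrite /path_cat_fun H1 K1.
- move=> t /=; rewrite path_zero uval0 invr_ge0 ler0n clip_le0; last by lra.
  by rewrite Hz path_zero.
- move=> t /=; rewrite path_one uval1 ifF; last first.
    by apply/negbTE; rewrite -ltNge; lra.
  by rewrite clip_ge1 ?Ko ?path_one//; lra.
Qed.

Lemma path_rev_homotopic (x y x' y' : X)
    (p : {path I from x to y}) (p' : {path I from x' to y'}) :
  path_homotopic p p' -> path_homotopic (path_rev p) (path_rev p').
Proof.
move=> [H [cH H0 H1 Hz Ho]].
exists (fun w => H (clip (- 1 * uval w.1 + 1), w.2)); split.
- apply: comp_continuous cH; apply: pair_continuous.
    exact/clip_comp_continuous/affine_continuous/ufst_continuous.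
  by move=> -[s t]; exact: cvg_snd.
- by move=> s /=; rewrite H0 mulN1r addrC.
- by move=> s /=; rewrite H1 mulN1r addrC.
- by move=> t /=; rewrite uval0 mulr0 add0r Ho path_zero path_one.
- by move=> t /=; rewrite uval1 mulr1 addNr Hz path_zero path_one.
Qed.

End path_homotopy.

Section path_groupoid.
Context {R : realType} {X : topologicalType}.
Local Notation I := (unit_interval R).

Lemma path_homotopic_same (f g : I -> X) :
  continuous f -> f =1 g -> path_homotopic f g.
Proof. by move=> cf /funext <-; exact: path_homotopic_refl. Qed.

Let uaff_continuous (a b : R) : continuous (fun t : I => a * uval t + b).
Proof. exact/affine_continuous/uval_continuous. Qed.

Let umin_continuous (u v : I -> R) : continuous u -> continuous v ->
  continuous (fun t => Num.min (u t) (v t)).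
Proof. by move=> cu cv t; apply: continuous_min; [exact: cu|exact: cv]. Qed.

Let umax_continuous (u v : I -> R) : continuous u -> continuous v ->
  continuous (fun t => Num.max (u t) (v t)).
Proof. by move=> cu cv t; apply: continuous_max; [exact: cu|exact: cv]. Qed.

Let path_continuous (x y : X) (p : {path I from x to y}) :
  continuous (p : I -> X).
Proof. exact: cts_fun. Qed.

Lemma path_catA (x y z w : X) (p : {path I from x to y})
    (q : {path I from y to z}) (r : {path I from z to w}) :
  path_homotopic (path_cat p (path_cat q r)) (path_cat (path_cat p q) r).
Proof.
pose phi : I -> R := fun s => Num.min (2 * uval s + 0)
  (Num.min (1 * uval s + 4^-1) (2^-1 * uval s + 2^-1)).
have cphi : continuous phi.
  by apply: umin_continuous => //; apply: umin_continuous.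
have -> : (path_cat p (path_cat q r) : I -> X) =
    path_cat p (path_cat q r) \o clip \o (fun s => 1 * uval s + 0).
  by apply/funext => s /=; rewrite mul1r addr0 uvalK.
have -> : (path_cat (path_cat p q) r : I -> X) =
    path_cat p (path_cat q r) \o clip \o phi.
  apply/funext => s; rewrite /= !path_catE /phi.
  have /andP[s0 s1] := uval_itv s.
  case: (leP (uval s) 2^-1) => s2.
    rewrite (@clipK _ (2 * _ + 0)); last by lra.
    case: (leP (2 * uval s + 0) 2^-1) => s4.
      rewrite (@min_l _ _ (2 * _ + 0)); last by rewrite le_min; lra.
      by rewrite clipK ?s4//; lra.
    rewrite (@min_l _ _ (1 * _ + _)); last by lra.
    rewrite min_r; last by lra.
    rewrite clipK; last by lra.
    rewrite ifF; last by lra.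
    rewrite clipK; last by lra.
    rewrite ifT; last by lra.
    by congr (q (clip _)); lra.
  rewrite (@min_r _ _ (1 * _ + _)); last by lra.
  rewrite min_r; last by lra.
  rewrite clipK; last by lra.
  rewrite ifF; last by lra.
  rewrite clipK; last by lra.
  rewrite ifF; last by lra.
  by congr (r (clip _)); lra.
apply: path_homotopic_reparam => //.
- by rewrite /phi uval0 min_l ?le_min; lra.
- by rewrite /phi uval1 (@min_r _ _ (1 * _ + _)) ?min_r; lra.
Qed.

Lemma path_cat1p (x y : X) (p : {path I from x to y}) :
  path_homotopic (path_cat (path_cst x) p) p.
Proof.
pose phi : I -> R := fun s => Num.max (0 * uval s + 0) (2 * uval s - 1).
have cphi : continuous phi by exact: umax_continuous.
have e : (p : I -> X) = p \o clip \o (fun s => 1 * uval s + 0).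
  by apply/funext => s /=; rewrite mul1r addr0 uvalK.
rewrite e; have -> : (path_cat (path_cst x) p : I -> X) = p \o clip \o phi.
  apply/funext => s; rewrite /= path_catE /phi.
  case: (leP (uval s) 2^-1) => s2.
    rewrite max_l; last by lra.
    by rewrite (@clip_le0 _ (0 * _ + _)) ?path_zero//; lra.
  by rewrite max_r//; lra.
apply: path_homotopic_reparam => //.
- by rewrite /phi uval0 max_l; lra.
- by rewrite /phi uval1 max_r; lra.
Qed.

Lemma path_catp1 (x y : X) (p : {path I from x to y}) :
  path_homotopic (path_cat p (path_cst y)) p.
Proof.
pose phi : I -> R := fun s => Num.min (0 * uval s + 1) (2 * uval s + 0).
have cphi : continuous phi by exact: umin_continuous.
have e : (p : I -> X) = p \o clip \o (fun s => 1 * uval s + 0).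
  by apply/funext => s /=; rewrite mul1r addr0 uvalK.
rewrite e; have -> : (path_cat p (path_cst y) : I -> X) = p \o clip \o phi.
  apply/funext => s; rewrite /= path_catE /phi.
  case: (leP (uval s) 2^-1) => s2.
    by rewrite min_r//; lra.
  rewrite min_l; last by lra.
  by rewrite (@clip_ge1 _ (0 * _ + _)) ?path_one//; lra.
apply: path_homotopic_reparam => //.
- by rewrite /phi uval0 min_r; lra.
- by rewrite /phi uval1 min_l; lra.
Qed.

Lemma path_catpV (x y : X) (p : {path I from x to y}) :
  path_homotopic (path_cat p (path_rev p)) (path_cst x).
Proof.
pose phi : I -> R := fun s => Num.min (2 * uval s + 0) (- 2 * uval s + 2).
have cphi : continuous phi by exact: umin_continuous.
have -> : (path_cst x : I -> X) = p \o clip \o (fun s => 0 * uval s + 0).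
  by apply/funext => s /=; rewrite mul0r addr0 clip_le0 ?path_zero.
have -> : (path_cat p (path_rev p) : I -> X) = p \o clip \o phi.
  apply/funext => s; rewrite /= path_catE ?path_revE /phi.
  have /andP[s0 s1] := uval_itv s.
  case: (leP (uval s) 2^-1) => s2.
    by rewrite min_l//; lra.
  rewrite min_r; last by lra.
  by rewrite clipK; [congr (p (clip _))|]; lra.
apply: path_homotopic_reparam => //.
- by rewrite /phi uval0 min_l; lra.
- by rewrite /phi uval1 min_r; lra.
Qed.

Lemma path_catVp (x y : X) (p : {path I from x to y}) :
  path_homotopic (path_cat (path_rev p) p) (path_cst y).
Proof.
pose phi : I -> R := fun s => Num.max (- 2 * uval s + 1) (2 * uval s - 1).
have cphi : continuous phi by exact: umax_continuous.
have -> : (path_cst y : I -> X) = p \o clip \o (fun s => 0 * uval s + 1).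
  by apply/funext => s /=; rewrite mul0r add0r clip_ge1 ?path_one.
have -> : (path_cat (path_rev p) p : I -> X) = p \o clip \o phi.
  apply/funext => s; rewrite /= path_catE ?path_revE /phi.
  have /andP[s0 s1] := uval_itv s.
  case: (leP (uval s) 2^-1) => s2.
    rewrite max_l; last by lra.
    by rewrite clipK; [congr (p (clip _))|]; lra.
  by rewrite max_r//; lra.
apply: path_homotopic_reparam => //.
- by rewrite /phi uval0 max_l; lra.
- by rewrite /phi uval1 max_r; lra.
Qed.

End path_groupoid.

Section fundamental_group.
Variables (R : realType) (X : topologicalType) (x0 : X).
Local Notation I := (unit_interval R).
Local Notation loop := {path I from x0 to x0}.

Definition loop_equiv (p q : loop) : bool := `[< path_homotopic p q >].

Lemma loop_equiv_refl : reflexive loop_equiv.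
Proof. by move=> p; apply/asboolP/path_homotopic_refl/cts_fun. Qed.

Lemma loop_equiv_sym : symmetric loop_equiv.
Proof.
by move=> p q; apply/idP/idP => /asboolP/path_homotopic_sym h; exact/asboolP.
Qed.

Lemma loop_equiv_trans : transitive loop_equiv.
Proof.
move=> q p r /asboolP pq /asboolP qr; apply/asboolP.
exact: path_homotopic_trans pq qr.
Qed.

Canonical loop_equivRel :=
  EquivRel loop_equiv loop_equiv_refl loop_equiv_sym loop_equiv_trans.

Definition pi1 : Type := {eq_quot loop_equiv}.

HB.instance Definition _ := Choice.on pi1.
HB.instance Definition _ := EqQuotient.on pi1.

Lemma pi1P (p q : loop) : \pi_pi1 p = \pi_pi1 q <-> path_homotopic p q.
Proof.
by split=> [/eqP|h]; [|apply/eqP]; rewrite piE => *; exact/asboolP.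
Qed.

Definition pi1_one : pi1 := \pi_pi1 (path_cst x0).
Definition pi1_mul (a b : pi1) : pi1 := \pi_pi1 (path_cat (repr a) (repr b)).
Definition pi1_inv (a : pi1) : pi1 := \pi_pi1 (path_rev (repr a)).

Lemma pi1_reprK (p : loop) : path_homotopic (repr (\pi_pi1 p)) p.
Proof. by apply/pi1P; rewrite reprK. Qed.

Lemma pi1_mulE (p q : loop) :
  pi1_mul (\pi_pi1 p) (\pi_pi1 q) = \pi_pi1 (path_cat p q).
Proof. by apply/pi1P/path_cat_homotopic; exact: pi1_reprK. Qed.

Lemma pi1_invE (p : loop) : pi1_inv (\pi_pi1 p) = \pi_pi1 (path_rev p).
Proof. by apply/pi1P/path_rev_homotopic; exact: pi1_reprK. Qed.

Lemma pi1_mulA : associative pi1_mul.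
Proof.
move=> a b c; rewrite -[a]reprK -[b]reprK -[c]reprK.
rewrite (pi1_mulE (repr a) (repr b)) (pi1_mulE (repr b) (repr c)) 2!pi1_mulE.
exact/pi1P/path_catA.
Qed.

Lemma pi1_mul1g : left_id pi1_one pi1_mul.
Proof. by move=> a; rewrite -[a]reprK pi1_mulE; exact/pi1P/path_cat1p. Qed.

Lemma pi1_mulg1 : right_id pi1_one pi1_mul.
Proof. by move=> a; rewrite -[a]reprK pi1_mulE; exact/pi1P/path_catp1. Qed.

Lemma pi1_mulVg : left_inverse pi1_one pi1_inv pi1_mul.
Proof.
by move=> a; rewrite -[a]reprK pi1_invE pi1_mulE; exact/pi1P/path_catVp.
Qed.

Lemma pi1_mulgV : right_inverse pi1_one pi1_inv pi1_mul.
Proof.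
by move=> a; rewrite -[a]reprK pi1_invE pi1_mulE; exact/pi1P/path_catpV.
Qed.

HB.instance Definition _ := isGroup.Build pi1
  pi1_mulA pi1_mul1g pi1_mulg1 pi1_mulVg pi1_mulgV.

End fundamental_group.

Definition normal_subgroup (G : groupType) (N : set G) : Prop :=
  [/\ N 1%g,
      forall a b, N a -> N b -> N (a * b)%g,
      forall a, N a -> N a^-1%g &
      forall a g, N a -> N (a ^ g)%g].

Definition normal_closure (G : groupType) (A : set G) : set G :=
  smallest (@normal_subgroup G) A.

Definition homeomorphism (Y Z : topologicalType) (h : Y -> Z) : Prop :=
  continuous h /\
  exists g : Z -> Y, [/\ continuous g, cancel h g & cancel g h].

Definition equivalent_covers (X Y Z : topologicalType)
    (p : Y -> X) (q : Z -> X) : Prop :=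
  exists h : Y -> Z, homeomorphism h /\ forall y, q (h y) = p y.

Section spaces.
Variables (R : realType) (X : topologicalType).
Local Notation I := (unit_interval R).

Definition path_connected (A : set X) : Prop :=
  forall x y, A x -> A y ->
    exists p : {path I from x to y}, forall t, A (p t).

Definition locally_path_connected : Prop :=
  forall (x : X) (U : set X), nbhs x U ->
    exists V, [/\ open V, V x, V `<=` U & path_connected V].

Definition metrizable : Prop :=
  exists (M : metricType R) (h : X -> M), homeomorphism h.

Definition peano_continuum : Prop :=
  [/\ compact [set: X], connected [set: X], locally_path_connected &
      metrizable].

Definition semilocally_simply_connected : Prop :=
  forall x : X, exists2 U, nbhs x U &
    forall p : {path I from x to x}, (forall t, U (p t)) ->
      path_homotopic p (path_cst x).

End spaces.

Section universal_cover.
Variables (R : realType) (X : topologicalType) (x0 : X).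
Local Notation I := (unit_interval R).

Definition based_path : Type := {y : X & {path I from x0 to y}}.

HB.instance Definition _ := gen_eqMixin based_path.
HB.instance Definition _ := gen_choiceMixin based_path.

Definition Based (y : X) (p : {path I from x0 to y}) : based_path :=
  existT _ y p.

Definition based_equiv (p q : based_path) : bool :=
  `[< path_homotopic (projT2 p) (projT2 q) >].

Lemma based_equiv_refl : reflexive based_equiv.
Proof. by move=> p; apply/asboolP/path_homotopic_refl/cts_fun. Qed.

Lemma based_equiv_sym : symmetric based_equiv.
Proof.
by move=> p q; apply/idP/idP => /asboolP/path_homotopic_sym h; exact/asboolP.
Qed.

Lemma based_equiv_trans : transitive based_equiv.
Proof.
move=> q p r /asboolP pq /asboolP qr; apply/asboolP.
exact: path_homotopic_trans pq qr.
Qed.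

Canonical based_equivRel :=
  EquivRel based_equiv based_equiv_refl based_equiv_sym based_equiv_trans.

Definition universal_cover : Type := {eq_quot based_equiv}.

HB.instance Definition _ := Choice.on universal_cover.
HB.instance Definition _ := EqQuotient.on universal_cover.

Definition endpoint (a : universal_cover) : X := projT1 (repr a).

Lemma universal_coverP (p q : based_path) :
  \pi_universal_cover p = \pi_universal_cover q <->
  path_homotopic (projT2 p) (projT2 q).
Proof.
by split=> [/eqP|h]; [|apply/eqP]; rewrite piE => *; exact/asboolP.
Qed.

Lemma endpointE (p : based_path) : endpoint (\pi_universal_cover p) = projT1 p.
Proof.
have /universal_coverP/path_homotopic_ends[_] := reprK (\pi_universal_cover p).
by rewrite !path_one.
Qed.

(* The classes [p q] with p in the class a and q a path in V starting at the
   endpoint of p; for V open these sets are the usual basis of the topology of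
   the universal cover. *)
Definition whisker (a : universal_cover) (V : set X) : set universal_cover :=
  [set b | exists (y z : X)
      (p : {path I from x0 to y}) (q : {path I from y to z}),
    [/\ a = \pi_universal_cover (Based p), forall t, V (q t) &
        b = \pi_universal_cover (Based (path_cat p q))]].

Definition universal_cover_open (U : set universal_cover) : Prop :=
  forall a, U a ->
    exists V, [/\ open V, V (endpoint a) & whisker a V `<=` U].

Lemma universal_cover_openT : universal_cover_open setT.
Proof. by move=> a _; exists setT; split=> //; exact: openT. Qed.

Lemma whiskerS (a : universal_cover) (V W : set X) :
  V `<=` W -> whisker a V `<=` whisker a W.
Proof.
move=> VW b [y [z [p [q [ap qV bpq]]]]]; exists y, z, p, q.
by split=> // t; exact/VW.
Qed.

Lemma universal_cover_openI : setI_closed universal_cover_open.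
Proof.
move=> A B oA oB a [/oA[V [oV Va VA]] /oB[W [oW Wa WB]]].
exists (V `&` W); split=> //; first exact: openI.
by move=> b ab; split; [apply: VA|apply: WB]; apply: whiskerS ab => x [].
Qed.

Lemma universal_cover_open_bigU (J : Type) (f : J -> set universal_cover) :
  (forall j, universal_cover_open (f j)) -> universal_cover_open (\bigcup_j f j).
Proof.
move=> of_ a [j _ /of_[V [oV Va VA]]]; exists V; split=> // b /VA fb.
by exists j.
Qed.

HB.instance Definition _ := isOpenTopological.Build universal_cover
  universal_cover_openT universal_cover_openI universal_cover_open_bigU.

(* [g] . [p] = [g p]: the fundamental group acts on the left, by loops prepended
   to the path. *)
Definition deck_act (g : pi1 R x0) (a : universal_cover) : universal_cover :=
  \pi_universal_cover (Based (path_cat (repr g) (projT2 (repr a)))).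

Lemma deck_actE (g : {path I from x0 to x0}) (p : based_path) :
  deck_act (\pi_(pi1 R x0) g) (\pi_universal_cover p) =
  \pi_universal_cover (Based (path_cat g (projT2 p))).
Proof.
apply/universal_coverP/path_cat_homotopic => /=; first exact: pi1_reprK.
by apply/universal_coverP; rewrite reprK.
Qed.

Lemma endpoint_deck_act (g : pi1 R x0) (a : universal_cover) :
  endpoint (deck_act g a) = endpoint a.
Proof. by rewrite endpointE. Qed.

Section orbit_space.
Variable N : set (pi1 R x0).

Definition deck_orbit (a : universal_cover) : set universal_cover :=
  [set deck_act g a | g in N].

(* For a subgroup N this says that a and b lie in the same N-orbit; stated as an
   equality of orbits it is an equivalence relation for every N. *)
Definition orbit_equiv (a b : universal_cover) : bool :=
  `[< deck_orbit a = deck_orbit b >].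

Lemma orbit_equiv_refl : reflexive orbit_equiv.
Proof. by move=> a; exact/asboolP. Qed.

Lemma orbit_equiv_sym : symmetric orbit_equiv.
Proof. by move=> a b; apply/asboolP/asboolP => ->. Qed.

Lemma orbit_equiv_trans : transitive orbit_equiv.
Proof. by move=> b a c /asboolP ab /asboolP bc; apply/asboolP; rewrite ab. Qed.

Canonical orbit_equivRel :=
  EquivRel orbit_equiv orbit_equiv_refl orbit_equiv_sym orbit_equiv_trans.

Definition orbit_space : Type := quotient_topology {eq_quot orbit_equiv}.

HB.instance Definition _ := Topological.on orbit_space.
HB.instance Definition _ := Quotient.on orbit_space.

Definition cover_of (c : orbit_space) : X := endpoint (repr c).

Lemma cover_ofE (a : universal_cover) : N 1%g ->
  cover_of (\pi_orbit_space a) = endpoint a.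
Proof.
move=> N1; set b := repr (\pi_orbit_space a).
have /eqP : \pi_{eq_quot orbit_equiv} b = \pi_{eq_quot orbit_equiv} a.
  exact: reprK.
rewrite piE => /asboolP ba.
have [g _ gab] : deck_orbit a (deck_act 1%g b).
  by rewrite -ba; exists 1%g.
by rewrite /cover_of -/b -(endpoint_deck_act 1%g b) -gab endpoint_deck_act.
Qed.

End orbit_space.

End universal_cover.

Arguments cover_of {R X x0} N c.

Section entourages.
Variable X : topologicalType.

Definition is_entourage (E : set (X * X)) : Prop :=
  (forall x y, E (x, y) -> E (y, x)) /\
  exists W : set (X * X), [/\ open W, forall x, W (x, x) & W `<=` E].

Record entourage_of := EntourageOf {
  entourage_set :> set (X * X);
  entourageP : is_entourage entourage_set
}.

Implicit Types (E F : set (X * X)) (x y : X) (s t : seq X).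

(* The nonempty sequence {x, s_1, ..., s_n} is encoded by x and s, so its
   endpoint is last x s. *)
Definition echain E x s : bool := path (fun a b => (a, b) \in E) x s.

Definition chained E : Prop :=
  E `<=` closure (interior E) /\
  forall x y, E (x, y) -> forall F, is_entourage F ->
    exists s, [/\ echain F x s, last x s = y &
      forall z, z \in x :: s -> (xsection E x `&` xsection E y) z].

(* The condition s2 != [::] prevents the inserted point from becoming the
   endpoint; the second constructor is the convention {x, x} = {x}. *)
Inductive echain_move E x : seq X -> seq X -> Prop :=
| echain_insert s1 y s2 : s2 != [::] ->
    echain E x (s1 ++ s2) -> echain E x (s1 ++ y :: s2) ->
    echain_move E x (s1 ++ s2) (s1 ++ y :: s2)
| echain_const : echain E x [:: x] -> echain_move E x [::] [:: x].

Definition echain_homotopic E x : seq X -> seq X -> Prop :=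
  clos_refl_sym_trans (seq X) (echain_move E x).

Lemma echain_homotopic_last E x s t :
  echain_homotopic E x s t -> last x s = last x t.
Proof.
elim=> {s t} [s t st| | |s u t _ -> _ ->] //.
by case: st => // s1 y [|z s2] // _ _ _; rewrite !last_cat.
Qed.

End entourages.

Section entourage_cover.
Variables (X : topologicalType) (E : entourage_of X) (x0 : X).

Definition based_echain : Type := {s : seq X | echain E x0 s}.

HB.instance Definition _ := Choice.on based_echain.
HB.instance Definition _ := SubType.on based_echain.

Definition echain_equiv (s t : based_echain) : bool :=
  `[< echain_homotopic E x0 (val s) (val t) >].

Lemma echain_equiv_refl : reflexive echain_equiv.
Proof. by move=> s; apply/asboolP/rst_refl. Qed.

Lemma echain_equiv_sym : symmetric echain_equiv.
Proof. by move=> s t; apply/asboolP/asboolP; exact: rst_sym. Qed.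

Lemma echain_equiv_trans : transitive echain_equiv.
Proof.
move=> t s u /asboolP st /asboolP tu; apply/asboolP.
exact: (rst_trans _ _ _ _ _ st tu).
Qed.

Canonical echain_equivRel :=
  EquivRel echain_equiv echain_equiv_refl echain_equiv_sym echain_equiv_trans.

Definition entourage_space : Type := {eq_quot echain_equiv}.

HB.instance Definition _ := Choice.on entourage_space.
HB.instance Definition _ := EqQuotient.on entourage_space.

Definition entourage_map (a : entourage_space) : X := last x0 (val (repr a)).

Lemma entourage_spaceP (s t : based_echain) :
  \pi_entourage_space s = \pi_entourage_space t <->
  echain_homotopic E x0 (val s) (val t).
Proof.
by split=> [/eqP|h]; [|apply/eqP]; rewrite piE => *; exact/asboolP.
Qed.

Lemma entourage_mapE (s : based_echain) :
  entourage_map (\pi_entourage_space s) = last x0 (val s).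
Proof.
by apply: (@echain_homotopic_last _ E); apply/entourage_spaceP; rewrite reprK.
Qed.

(* For alpha = {x0, s} with endpoint x and beta = {x0, t}, the concatenation of
   the reversal of alpha with beta is {x, rev (belast x0 s) ++ t}, in which the
   common point x0 occurs once. *)
Definition entourage_star (F : set (X * X)) :
    set (entourage_space * entourage_space) :=
  [set ab | exists s t : based_echain,
    let x := last x0 (val s) in let y := last x0 (val t) in
    [/\ ab = (\pi_entourage_space s, \pi_entourage_space t), F (x, y) &
        echain_homotopic E x (rev (belast x0 (val s)) ++ val t) [:: y]]].

Definition entourage_space_open (U : set entourage_space) : Prop :=
  forall a, U a -> exists F : set (X * X),
    [/\ is_entourage F, F `<=` E & xsection (entourage_star F) a `<=` U].

Lemma entourage_space_openT : entourage_space_open setT.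
Proof. by move=> a _; exists E; split=> //; exact: entourageP. Qed.

Lemma entourage_starS (F G : set (X * X)) :
  F `<=` G -> entourage_star F `<=` entourage_star G.
Proof.
by move=> FG _ [s [t [-> Fst h]]]; exists s, t; split=> //; exact: FG.
Qed.

Lemma is_entourageI (F G : set (X * X)) :
  is_entourage F -> is_entourage G -> is_entourage (F `&` G).
Proof.
move=> [sF [V [oV dV VF]]] [sG [W [oW dW WG]]]; split.
  by move=> x y [/sF Fyx /sG Gyx].
exists (V `&` W); split; [exact: openI|by []|exact: setISS].
Qed.

Lemma entourage_space_openI : setI_closed entourage_space_open.
Proof.
move=> A B oA oB a [/oA[F [eF FE FA]] /oB[G [eG GE GB]]].
exists (F `&` G); split.
- exact: is_entourageI eF eG.
- by move=> z [/FE].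
- by move=> b /xsectionP h; split; [apply: FA|apply: GB];
    apply/xsectionP; apply: entourage_starS h => z [].
Qed.

Lemma entourage_space_open_bigU (J : Type) (f : J -> set entourage_space) :
  (forall j, entourage_space_open (f j)) -> entourage_space_open (\bigcup_j f j).
Proof.
move=> of_ a [j _ /of_[F [eF FE FA]]]; exists F; split=> // b /FA fb.
by exists j.
Qed.

(* The balls of entourage_star F around a are a basis of neighbourhoods of a;
   they need not be open themselves, as F need not be. *)
HB.instance Definition _ := isOpenTopological.Build entourage_space
  entourage_space_openT entourage_space_openI entourage_space_open_bigU.

End entourage_cover.

Arguments entourage_map {X} E x0 a.

(* Main.v *)
Require Import Defs.
From Stdlib Require Import Relation_Operators.
From mathcomp Require Import all_boot all_order all_algebra.
From mathcomp Require Import generic_quotient.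
From mathcomp Require Import all_classical all_reals all_analysis.
From mathcomp Require Import homotopy lra.

(** Cover [X] by finitely many path connected open cells [U i] with
    [U i x U i] inside [E], so small that two paths with the same endpoints,
    each inside one cell, are homotopic.  A chain whose steps stay in cells
    ("cell chain") then has a well-defined class in the fundamental groupoid,
    every loop is homotopic to such a chain, and lifting through the given
    homeomorphism shows that a cell loop lies in [N] iff it is
    [E]-null-homotopic.

    As [E] is chained, any [(x, y)] in [E] can be joined by a cell chain inside
    [B(x, E)] and [B(y, E)], which is therefore [E]-homotopic to [{x, y}].
    The key point is that this chain can be taken of length at most the number
    [n] of cells, by cutting out the detours between two visits of the same
    cell.  Hence a single step of an [E]-homotopy alters the class of the
    associated cell chain by a conjugate of an [E]-null-homotopic cell loop of
    length at most [3n], and [N] is normally generated by the classes of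
    [E]-null-homotopic cell loops of length at most [3n + 1].  Up to conjugacy
    the class of a cell loop is determined by the word of cells it traverses, so
    finitely many suffice. *)

Set Implicit Arguments.
Unset Strict Implicit.
Unset Printing Implicit Defensive.

Import Order.TTheory GRing.Theory Num.Theory.
Import numFieldNormedType.Exports.

Local Open Scope classical_set_scope.
Local Open Scope ring_scope.
Local Open Scope quotient_scope.

(** * The fundamental groupoid *)

(** Both [P] and its complement are open. Applied to the unit interval, this induction along a path
    takes the place of a subdivision by a Lebesgue number. *)
Lemma connected_locally_constant (T : topologicalType) (P : T -> Prop) :
  connected [set: T] -> (forall x, nbhs x [set y | P y <-> P x]) ->
  forall x y, P x -> P y.
Proof.
move=> cT lP x y Px.
have oP : open P.
  by rewrite openE => z Pz; apply: filterS (lP z) => t [_]; exact.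
have cP : closed P.
  rewrite -openC openE => z nPz; apply: filterS (lP z) => t [tz _] Pt.
  exact/nPz/tz.
have -> // : P = setT.
by apply: cT; [exists x|exists P; rewrite ?setTI..].
Qed.

Lemma unit_interval_connected (R : realType) :
  connected [set: unit_interval R].
Proof.
have -> : [set: unit_interval R] = clip @` `[0 : R, 1]%classic.
  apply/seteqP; split=> // t _; exists (uval t); last exact: uvalK.
  by rewrite /= in_itv /= uval_itv.
apply: connected_continuous_connected; first exact: segment_connected.
by apply: continuous_subspaceT => r; exact: clip_continuous.
Qed.

Section paths.
Context {R : realType} {X : topologicalType}.
Local Notation I := (unit_interval R).
Local Notation "p ~~> q" := (path_homotopic p q) (at level 70).

Lemma path_refl (x y : X) (p : {path I from x to y}) : p ~~> p.
Proof. exact/path_homotopic_refl/cts_fun. Qed.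

Lemma path_cat_in (U : set X) (x y z : X) (p : {path I from x to y})
    (q : {path I from y to z}) :
  (forall t, U (p t)) -> (forall t, U (q t)) -> forall t, U (path_cat p q t).
Proof. by move=> pU qU t; rewrite path_catE; case: ifP. Qed.

Lemma path_rev_in (U : set X) (x y : X) (p : {path I from x to y}) :
  (forall t, U (p t)) -> forall t, U (path_rev p t).
Proof. by move=> pU t; rewrite path_revE. Qed.

Lemma peano_path_connected :
  peano_continuum R X -> path_connected R [set: X].
Proof.
move=> [_ cX lX _] x y _ _.
pose P z := exists p : {path I from x to z}, True.
suff: P y by move=> [p _]; exists p.
apply: (connected_locally_constant cX) (_ : P x); last by exists (path_cst x).
move=> z; have [V [oV Vz _ pV]] := lX z setT (filterT).
apply: (@filterS _ _ _ V); last exact: open_nbhs_nbhs.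
move=> t Vt; have [q _] := pV _ _ Vz Vt.
by split=> -[p _]; [exists (path_cat p (path_rev q))|exists (path_cat p q)].
Qed.

Lemma path_cat_cancelr (x y z : X) (p p' : {path I from x to y})
    (q : {path I from y to z}) :
  path_cat p q ~~> path_cat p' q -> p ~~> p'.
Proof.
move=> h.
have key (u : {path I from x to y}) :
    path_cat (path_cat u q) (path_rev q) ~~> u.
  apply: path_homotopic_trans (path_catp1 u).
  apply: path_homotopic_trans (path_homotopic_sym (path_catA _ _ _)) _.
  by apply: path_cat_homotopic (path_catpV q); exact: path_refl.
apply: path_homotopic_trans (path_homotopic_sym (key p)) _.
apply: path_homotopic_trans (key p').
by apply: path_cat_homotopic h _; exact: path_refl.
Qed.

Lemma path_cat_cancell (x y z : X) (p : {path I from x to y})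
    (q q' : {path I from y to z}) :
  path_cat p q ~~> path_cat p q' -> q ~~> q'.
Proof.
move=> h.
have key (u : {path I from y to z}) :
    path_cat (path_rev p) (path_cat p u) ~~> u.
  apply: path_homotopic_trans (path_cat1p u).
  apply: path_homotopic_trans (path_catA _ _ _) _.
  by apply: path_cat_homotopic (path_catVp p) _; exact: path_refl.
apply: path_homotopic_trans (path_homotopic_sym (key q)) _.
apply: path_homotopic_trans (key q').
by apply: path_cat_homotopic _ h; exact: path_refl.
Qed.

End paths.

(* Closing up paths by a choice of paths [r x] from the basepoint turns
   computations in the fundamental groupoid into computations in [pi1]. *)
Section path_class.
Context {R : realType} {X : topologicalType} {x0 : X}.
Local Notation I := (unit_interval R).
Local Notation "p ~~> q" := (path_homotopic p q) (at level 70).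
Variable r : forall x : X, {path I from x0 to x}.
Arguments r : clear implicits.

Definition path_class (x y : X) (p : {path I from x to y}) : pi1 R x0 :=
  \pi_(pi1 R x0) (path_cat (path_cat (r x) p) (path_rev (r y))).

Lemma path_classP (x y : X) (p q : {path I from x to y}) :
  path_class p = path_class q <-> p ~~> q.
Proof.
rewrite pi1P; split=> [/path_cat_cancelr/path_cat_cancell//|h].
by do 2?[apply: path_cat_homotopic => //]; exact: path_refl.
Qed.

Lemma path_class_cat (x y z : X) (p : {path I from x to y})
    (q : {path I from y to z}) :
  path_class (path_cat p q) = (path_class p * path_class q)%g.
Proof.
rewrite /path_class; apply/esym.
rewrite -[LHS]/(pi1_mul _ _) pi1_mulE; apply/pi1P.
apply: path_homotopic_trans (path_catA _ _ _) _.
apply: path_cat_homotopic; last exact: path_refl.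
apply: path_homotopic_trans (path_catA _ _ _) _.
apply: path_homotopic_trans; last exact: path_homotopic_sym (path_catA _ _ _).
apply: path_cat_homotopic; last exact: path_refl.
apply: path_homotopic_trans (path_homotopic_sym (path_catA _ _ _)) _.
apply: path_homotopic_trans (path_catp1 _).
by apply: path_cat_homotopic; [exact: path_refl|exact: path_catVp].
Qed.

Lemma path_class_cst (x : X) : path_class (path_cst x) = 1%g.
Proof.
apply: (@mulgI _ (path_class (path_cst x))); rewrite mulg1 -path_class_cat.
exact/path_classP/path_cat1p.
Qed.

Lemma path_class_rev (x y : X) (p : {path I from x to y}) :
  path_class (path_rev p) = (path_class p)^-1%g.
Proof.
apply: (@mulgI _ (path_class p)); rewrite mulgV -path_class_cat.
by rewrite -(path_class_cst x); exact/path_classP/path_catpV.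
Qed.

(** In general [path_class p] is the class of [p] conjugated by the loop [r x0]; a null-homotopic
    [r x0] removes the conjugation. *)
Lemma path_class_loop (p : {path I from x0 to x0}) :
  r x0 ~~> path_cst x0 -> path_class p = \pi_(pi1 R x0) p.
Proof.
move=> h; apply/pi1P; apply: path_homotopic_trans (path_cat1p p).
apply: path_homotopic_trans (path_catp1 _).
apply: path_cat_homotopic.
  by apply: path_cat_homotopic => //; exact: path_refl.
apply: path_homotopic_trans (path_rev_homotopic h) _.
apply: path_homotopic_trans (path_homotopic_sym (path_catp1 _)) _.
exact: path_catVp.
Qed.

End path_class.

(** * Homotopies of chains *)

Section echains.
Variables (X : topologicalType) (E : set (X * X)).
Hypothesis eE : is_entourage E.
Implicit Types (x y z : X) (s t u : seq X).

Lemma is_entourage_refl x : E (x, x).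
Proof. by have [_ [W [_ dW]]] := eE; exact. Qed.

Lemma is_entourage_sym x y : E (x, y) -> E (y, x).
Proof. by have [sE _] := eE; exact: sE. Qed.

Lemma echain_cat x s t :
  echain E x (s ++ t) = echain E x s && echain E (last x s) t.
Proof. exact: cat_path. Qed.

Lemma echain_consP x y s : echain E x (y :: s) <-> E (x, y) /\ echain E y s.
Proof.
rewrite /echain /=; split=> [/andP[xy ys]|[xy ys]].
  by split=> //; rewrite inE in xy.
by rewrite ys andbT inE.
Qed.

Lemma echain1 x y : echain E x [:: y] <-> E (x, y).
Proof. by rewrite echain_consP; split=> [[]|]. Qed.

(** When a chain is encoded by its first point and its tail, the reversed chain starts at [last x s]
    and has tail [rev (belast x s)]. *)
Lemma echain_rev x s : echain E x s -> echain E (last x s) (rev (belast x s)).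
Proof.
rewrite /echain rev_path; apply: sub_path => y z.
by rewrite !inE; exact: is_entourage_sym.
Qed.

Lemma echain_homotopic_refl x s : echain_homotopic E x s s.
Proof. exact: rst_refl. Qed.

Lemma echain_homotopic_sym x s t :
  echain_homotopic E x s t -> echain_homotopic E x t s.
Proof. exact: rst_sym. Qed.

Lemma echain_homotopic_trans x s t u :
  echain_homotopic E x s t -> echain_homotopic E x t u ->
  echain_homotopic E x s u.
Proof. exact: rst_trans. Qed.

Lemma echain_homotopic_catl x s t u : echain E x s ->
  echain_homotopic E (last x s) t u -> echain_homotopic E x (s ++ t) (s ++ u).
Proof.
move=> xs; elim=> {t u} [t u tu|t|t u _|t v u _ + _]; first last.
- exact: echain_homotopic_trans.
- exact: echain_homotopic_sym.
- exact: echain_homotopic_refl.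
apply: rst_step; case: tu => [t1 y t2 t2n c1 c2|c].
  by rewrite !catA; apply: echain_insert; rewrite // -catA echain_cat xs.
(* Placed after a chain ending in [z], the move from {z} to {z, z} becomes the insertion of a second
   [z] before the last one. *)
case: (lastP s) xs c => [_|s' z]; first exact: echain_const.
rewrite last_rcons => xs c; rewrite cats0 -[rcons s' z]cats1 -catA /=.
apply: echain_insert; rewrite // ?cats1 // -cat_rcons echain_cat xs.
by rewrite last_rcons c.
Qed.

Lemma echain_homotopic_catr x s t u : echain E (last x s) u ->
  echain_homotopic E x s t -> echain_homotopic E x (s ++ u) (t ++ u).
Proof.
move=> + st; elim: st => {s t} [s t st|s|s t st|s v t sv + _]; first last.
- move=> + + su => /(_ su) h1 h2; apply: echain_homotopic_trans h1 (h2 _).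
  by rewrite -(echain_homotopic_last sv).
- by move=> + tu => h; apply/echain_homotopic_sym/h;
    rewrite (echain_homotopic_last st).
- by move=> _; exact: echain_homotopic_refl.
case: st => [s1 y s2 s2n c1 c2|c] su.
  apply: rst_step; rewrite -!catA /=; apply: echain_insert.
  - by case: (s2) s2n.
  - by rewrite catA echain_cat c1.
  - rewrite -cat_cons catA echain_cat c2 /=; move: su.
    by case: (s2) s2n => // z s3 _; rewrite !last_cat.
(* Followed by a nonempty [u], the move from {x} to {x, x} becomes the insertion of [x] in front of
   [u]. *)
case: u su => [_|z u su].
  by apply: rst_step; exact: echain_const.
apply: rst_step; apply: (@echain_insert _ _ _ [::]); [by []|exact: su|].
by apply/echain_consP; split; [exact/echain1|exact: su].
Qed.

Lemma echain_homotopic_insert x y z :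
  E (x, y) -> E (y, z) -> E (x, z) -> echain_homotopic E x [:: z] [:: y; z].
Proof.
move=> xy yz xz; apply: rst_step; apply: (@echain_insert _ _ _ [::]) => //.
  exact/echain1.
by apply/echain_consP; split=> //; exact/echain1.
Qed.

Lemma echain_homotopic_cst x : echain_homotopic E x [::] [:: x].
Proof.
by apply: rst_step; apply: echain_const; exact/echain1/is_entourage_refl.
Qed.

Lemma echain_homotopic_back x y : E (x, y) ->
  echain_homotopic E x [:: y; x] [::].
Proof.
move=> xy; apply: echain_homotopic_sym.
apply: echain_homotopic_trans (echain_homotopic_cst x) _.
apply: echain_homotopic_insert => //; first exact: is_entourage_sym.
exact: is_entourage_refl.
Qed.

Lemma echain_homotopic_catV x s : echain E x s ->
  echain_homotopic E x (s ++ rev (belast x s)) [::].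
Proof.
elim: s x => [|y s IHs] x; first by move=> _; exact: echain_homotopic_refl.
move=> /echain_consP[xy ys] /=; rewrite rev_cons -cats1 catA.
have yx : echain E y [:: x] by exact/echain1/is_entourage_sym.
apply: echain_homotopic_trans (echain_homotopic_back xy).
apply: (@echain_homotopic_catl _ [:: y] _ [:: x]); first exact/echain1.
apply: (@echain_homotopic_catr _ _ [::]) (IHs _ ys).
rewrite last_cat; have := echain_homotopic_last (IHs _ ys).
by rewrite last_cat /= => ->.
Qed.

Lemma last_rev_belast x s : last (last x s) (rev (belast x s)) = x.
Proof. by case: s => // y s /=; rewrite rev_cons last_rcons. Qed.

Lemma belast_rev_belast x s : rev (belast (last x s) (rev (belast x s))) = s.
Proof.
suff : rev (last x s :: rev (belast x s)) = x :: s.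
  by rewrite lastI last_rev_belast rev_rcons => -[].
by rewrite -rev_rcons revK -lastI.
Qed.

Lemma echain_homotopic_catVl x s : echain E x s ->
  echain_homotopic E (last x s) (rev (belast x s) ++ s) [::].
Proof.
by move=> /echain_rev/echain_homotopic_catV; rewrite belast_rev_belast.
Qed.

Lemma echain_homotopic_echain x s t :
  echain_homotopic E x s t -> echain E x s = echain E x t.
Proof.
elim=> {s t} [s t st|s|s t _|s u t _ -> _ ->] //.
case: st => [s1 y s2 _ -> -> //|->]; first by [].
Qed.

Lemma echain_homotopic_cancell x s t u : echain E x s ->
  echain E (last x s) t -> echain_homotopic E x (s ++ t) (s ++ u) ->
  echain_homotopic E (last x s) t u.
Proof.
move=> xs st h; pose s' := rev (belast x s).
have xs' : echain E (last x s) s' by exact: echain_rev.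
have su : echain E (last x s) u.
  by have := echain_homotopic_echain h; rewrite !echain_cat xs st => /esym.
have key v : echain E (last x s) v ->
    echain_homotopic E (last x s) v (s' ++ s ++ v).
  move=> sv; apply: echain_homotopic_sym; rewrite catA.
  apply: (@echain_homotopic_catr _ _ [::]) (echain_homotopic_catVl xs).
  by rewrite last_cat last_rev_belast.
apply: echain_homotopic_trans (key _ st) _.
apply: echain_homotopic_trans (echain_homotopic_sym (key _ su)).
by apply: echain_homotopic_catl; rewrite // last_rev_belast.
Qed.

Lemma echain_homotopic_cancelr x s t u : echain E x s -> echain E x t ->
  echain E (last x s) u -> last x s = last x t ->
  echain_homotopic E x (s ++ u) (t ++ u) -> echain_homotopic E x s t.
Proof.
move=> xs xt su st h; pose u' := rev (belast (last x s) u).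
have key v : echain E x v -> last x v = last x s ->
    echain_homotopic E x v ((v ++ u) ++ u').
  move=> xv vs; apply: echain_homotopic_sym.
  rewrite -catA -[X in echain_homotopic _ _ _ X]cats0.
  by apply: echain_homotopic_catl; rewrite // vs; exact: echain_homotopic_catV.
apply: echain_homotopic_trans (key _ xs erefl) _.
apply: echain_homotopic_trans (echain_homotopic_sym (key _ xt (esym st))).
by apply: echain_homotopic_catr; rewrite // last_cat; exact: echain_rev.
Qed.

(** Delete the points from the front, one at a time: [x] is related to whichever point becomes its
    successor. This turns the ball condition in [chained] into a homotopy. *)
Lemma echain_homotopic_star x s : echain E x s -> s != [::] ->
  (forall z, z \in s -> E (x, z)) -> echain_homotopic E x s [:: last x s].
Proof.
elim: s => // y [|z s] IHs.
  by move=> _ _ _; exact: echain_homotopic_refl.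
move=> /echain_consP[xy /echain_consP[yz zs]] _ xE.
have xz : E (x, z) by apply: xE; rewrite !inE eqxx orbT.
apply: (@echain_homotopic_trans _ _ (z :: s)).
  apply: echain_homotopic_sym.
  apply: (@echain_homotopic_catr _ [:: z] [:: y; z]).
    exact: zs.
  exact: echain_homotopic_insert.
apply: IHs => //; first exact/echain_consP.
by move=> t ts; apply: xE; rewrite inE ts orbT.
Qed.

End echains.

(** * Chains of cells *)

Lemma normal_closure_normal (G : groupType) (A : set G) :
  normal_subgroup (normal_closure A).
Proof.
split=> [M [[] //]|a b aA bA M MA|a aA M MA|a g aA M MA].
- by have [[_ + _ _] _] := MA; apply; [exact: aA|exact: bA].
- by have [[_ _ + _] _] := MA; apply; exact: aA.
- by have [[_ _ _ +] _] := MA; apply; exact: aA.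
Qed.

Section normal_subgroup_theory.
Variables (G : groupType) (M : set G).
Hypothesis nM : normal_subgroup M.

Lemma normal_subgroup_conj a g : M (g * a * g^-1)%g <-> M a.
Proof.
have [_ _ _ MJ] := nM; split=> [/(MJ _ g)|/(MJ _ g^-1%g)].
  by rewrite conjgE !mulgA mulVg mul1g -mulgA mulVg mulg1.
by rewrite conjgE invgK mulgA.
Qed.

(** Membership of [a * b^-1] stands for equality of cosets of [M]. This lemma and the next two make
    it a congruence, so the quotient group is never formed. *)
Lemma normal_subgroup_divC a b : M (a * b^-1)%g -> M (b * a^-1)%g.
Proof. by have [_ _ MV _] := nM => /MV; rewrite invgM invgK. Qed.

Lemma normal_subgroup_div_trans a b c :
  M (a * b^-1)%g -> M (b * c^-1)%g -> M (a * c^-1)%g.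
Proof.
by have [_ MM _ _] := nM => ab bc; have := MM _ _ ab bc; rewrite mulgA mulgVK.
Qed.

Lemma normal_subgroup_div_mul a b c d :
  M (a * b^-1)%g -> M (c * d^-1)%g -> M (a * c * (b * d)^-1)%g.
Proof.
have [_ MM _ _] := nM => ab cd.
apply: (@normal_subgroup_div_trans _ (a * d)%g).
  rewrite invgM !mulgA -(mulgA a c).
  exact/normal_subgroup_conj.
by rewrite invgM !mulgA mulgK.
Qed.

End normal_subgroup_theory.

Section chain_products.
Variables (G : groupType) (X : Type) (e : X -> X -> G).
Implicit Types (x y z : X) (s t : seq X).

(** With [e x y] the class of a path from [x] to [y] inside one cell, this is the class of a path
    that follows the chain. *)
Fixpoint chain_prod x s : G :=
  if s is y :: s' then (e x y * chain_prod y s')%g else 1%g.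

Lemma chain_prod_cat x s t :
  chain_prod x (s ++ t) = (chain_prod x s * chain_prod (last x s) t)%g.
Proof.
by elim: s x => [|y s IHs] x /=; rewrite ?mul1g// IHs mulgA.
Qed.

End chain_products.

Section cells.
Variables (n : nat) (X : topologicalType) (U : 'I_n -> set X).
Implicit Types (x y z : X) (s t : seq X) (i j : 'I_n).

Definition cell_rel : set (X * X) := [set xy | exists i, U i xy.1 /\ U i xy.2].

(** Letter [i] is a cell containing both ends of the corresponding step. The word is kept as data
    because the final finiteness is a count of words. *)
Fixpoint cell_word (c : seq 'I_n) x s : Prop :=
  match c, s with
  | i :: c', y :: s' => [/\ U i x, U i y & cell_word c' y s']
  | [::], [::] => True
  | _, _ => False
  end.

Lemma echain_cell_word x s : echain cell_rel x s ->
  exists2 c, size c = size s & cell_word c x s.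
Proof.
elim: s x => [|y s IHs] x; first by exists [::].
rewrite /echain /= => /andP[]; rewrite inE => -[i [xi yi]] /IHs[c cs cys].
by exists (i :: c) => //=; rewrite cs.
Qed.

Hypothesis Ucover : forall x, exists i, U i x.

(* Pass to the graph whose vertices are the cells, adjacent when they meet
   inside [B], and cut the loops of the path of cells. *)
Lemma short_cell_chain (B : set X) x s :
  echain cell_rel x s -> (forall z, z \in x :: s -> B z) ->
  exists t, [/\ echain cell_rel x t, last x t = last x s,
    forall z, z \in t -> B z & (0 < size t <= n)%N].
Proof.
pose adj i j := `[< exists z, [/\ B z, U i z & U j z] >].
move=> xs sB.
have [i [xi [ps ips lps]]] : exists i, U i x /\
    (exists2 ps, path adj i ps & U (last i ps) (last x s)).
  elim: s x xs sB => [|z s IHs] x.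
    by move=> _ _; have [i xi] := Ucover x; exists i; split=> //; exists [::].
  rewrite /echain /= => /andP[]; rewrite inE => -[i [/= xi zi]] zs sB.
  have [j [zj [ps jps lps]]] : exists i, U i z /\
      (exists2 ps, path adj i ps & U (last i ps) (last z s)).
    by apply: IHs => // t ts; apply: sB; rewrite inE ts orbT.
  exists i; split=> //; exists (j :: ps) => //=; rewrite jps andbT.
  by apply/asboolP; exists z; split=> //; apply: sB; rewrite !inE eqxx orbT.
have [qs [iqs uqs lqs]] : exists qs, [/\ path adj i qs, uniq (i :: qs) &
    U (last i qs) (last x s)].
  by case: (shortenP ips) lps => qs iqs uqs _ lqs; exists qs.
have sqs : (size qs < n)%N.
  by have := max_card (mem (i :: qs)); rewrite (card_uniqP uqs) card_ord.
have yB : B (last x s) by apply: sB; exact: mem_last.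
(* One point in each meeting of consecutive cells, then the endpoint: as many points as cells, and
   in particular at least one. *)
suff : exists t, [/\ echain cell_rel x t,
    last x t = last x s, forall z, z \in t -> B z & size t = (size qs).+1].
  by move=> [t [xt lt tB st]]; exists t; split=> //; rewrite st.
move: (last x s) yB lqs => y yB {xs sB uqs sqs ips lps}.
elim: qs i x xi iqs => [|j qs IHqs] i x xi.
  move=> _ /= yi; exists [:: y]; split=> //.
    by rewrite /echain /= andbT inE; exists i.
  by move=> z; rewrite inE => /eqP ->.
move=> /= /andP[/asboolP[z [zB zi zj]] jqs] yl.
have [t [zt lt tB st]] := IHqs j z zj jqs yl.
exists (z :: t); split=> //=; last by rewrite st.
  by rewrite /echain /= -/(echain _ _ _) zt andbT inE; exists i.
by move=> v; rewrite inE => /predU1P[->|/tB].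
Qed.

Variables (G : groupType) (e : X -> X -> G).
Hypothesis e_cocycle : forall i x y z,
  U i x -> U i y -> U i z -> (e x y * e y z)%g = e x z.

Lemma cocycle1 i x : U i x -> e x x = 1%g.
Proof.
move=> xi; apply: (@mulgI _ (e x x)); rewrite mulg1.
exact: (e_cocycle xi xi xi).
Qed.

Lemma cocycleV i x y : U i x -> U i y -> e y x = (e x y)^-1%g.
Proof.
move=> xi yi; apply: (@mulgI _ (e x y)); rewrite mulgV.
by rewrite (e_cocycle xi yi xi) (cocycle1 xi).
Qed.

Lemma chain_prod_rev x s : echain cell_rel x s ->
  chain_prod e (last x s) (rev (belast x s)) = (chain_prod e x s)^-1%g.
Proof.
elim: s x => [|y s IHs] x; first by rewrite /= invg1.
rewrite /echain /= => /andP[]; rewrite inE => -[i [/= xi yi]] ys.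
rewrite rev_cons -cats1 chain_prod_cat IHs//= last_rev_belast mulg1.
by rewrite invgM (cocycleV xi yi).
Qed.

(** The two chains run through the same cells in step, so the cocycle rule fills the ladder between
    them. The word is nonempty because its first letter is what puts [z] and [z'] in one cell. *)
Lemma chain_prod_cell_word i c z z' s s' :
  cell_word (i :: c) z s -> cell_word (i :: c) z' s' ->
  chain_prod e z s =
    (e z z' * chain_prod e z' s' * e (last z' s') (last z s))%g.
Proof.
elim: c i z z' s s' => [|j c IHc] i z z' [//|y s] [//|y' s'] /=.
  move=> [zi yi]; case: s => // _ [zi' yi']; case: s' => // _ /=.
  rewrite !mulg1 (e_cocycle zi zi' yi').
  by rewrite (e_cocycle zi yi' yi).
move=> [zi yi ys] [zi' yi' ys']; rewrite (IHc _ _ _ _ _ ys ys').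
rewrite !mulgA; congr (_ * _ * _)%g.
rewrite (e_cocycle zi zi' yi').
by rewrite (e_cocycle zi yi yi').
Qed.

(** Loops with the same word have conjugate products, and there are finitely many words of length at
    most [L]; one representative in [N] per word is enough. *)
Lemma finite_loop_products (N : set G) (L : nat) : normal_subgroup N ->
  exists A : set G, [/\ finite_set A, A `<=` N &
    forall z s, echain cell_rel z s -> last z s = z -> (size s <= L)%N ->
      N (chain_prod e z s) -> normal_closure A (chain_prod e z s)].
Proof.
move=> nN; have [N1 _ _ _] := nN.
pose good c a := N a /\ exists z s, [/\ cell_word c z s, last z s = z &
  a = chain_prod e z s].
have /choice[rep repP] : forall c, exists a,
    N a /\ ((exists b, good c b) -> good c a).
  move=> c; have [[b bc]|nc] := pselect (exists b, good c b).
    by exists b; split=> //; case: bc.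
  (* A word carried by no loop with product in [N] gets the value [1], so that the finite set stays
     inside [N]. *)
  by exists 1%g; split.
exists [set rep (val c) | c in [set: L.-bseq 'I_n]]; split.
- exact/finite_image/finite_finset.
- by move=> _ [c _ <-]; have [] := repP (val c).
move=> z s /echain_cell_word[c cs czs] zz sL Nzs.
set A := [set _ | _ in _]; have nA := @normal_closure_normal _ A.
have [_ [|_ [z' [s' [cw lz' es']]]]] := repP c.
  by exists (chain_prod e z s); split=> //; exists z, s.
have Arep : normal_closure A (rep c).
  have cL : (size c <= L)%N by rewrite cs.
  by move=> M [_]; apply; exists (Bseq cL).
case: c cs czs cw Arep es' => [|i c] cs czs cw Arep es'.
  by case: (s) czs => // _; case: nA.
(* Both chains are loops, so the outer factors are [e z z'] and its inverse [e z' z]. *)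
rewrite (chain_prod_cell_word czs cw) -es' lz' zz.
have [zi zi'] : U i z /\ U i z'.
  by case: (s) (s') czs cw => [//|? ?] [//|? ?] [? _ _] [].
by rewrite (cocycleV zi zi'); apply/normal_subgroup_conj.
Qed.

End cells.

(** * Good covers and subdivision of paths *)

Section good_covers.
Context {R : realType} {X : topologicalType}.
Local Notation I := (unit_interval R).
Local Notation "p ~~> q" := (path_homotopic p q) (at level 70).

Lemma path_connected_base (x0 : X) : path_connected R [set: X] ->
  exists r : forall x : X, {path I from x0 to x}, r x0 ~~> path_cst x0.
Proof.
move=> pX.
have c x : exists p : {path I from x0 to x}, x = x0 -> p ~~> path_cst x0.
  have [->|xx0] := pselect (x = x0).
    by exists (path_cst x0) => _; exact: path_refl.
  by have [p _] := pX x0 x Logic.I Logic.I; exists p.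
exists (fun x => projT1 (cid (c x))).
by have := projT2 (cid (c x0)); apply.
Qed.

Lemma metrizable_accessible (x y : X) :
  metrizable R X -> x != y -> nbhs x [set z | z != y].
Proof.
move=> [M [h [ch [g [cg hK gK]]]]] xy.
have : nbhs (h x) [set m | m != h y].
  apply: open_nbhs_nbhs; split; last by rewrite /= (can_eq hK).
  have M1 := hausdorff_accessible (@metric_hausdorff R M).
  have := @accessible_closed_set1 M M1 (h y).
  by rewrite -openC; congr open; apply/seteqP; split=> m /eqP.
move/ch; rewrite nbhs_simpl /=; apply: filterS => z /=.
by rewrite (can_eq hK).
Qed.

(** The semilocal hypothesis at [x] concerns only loops based at [x]. A loop at another point [y] of
    [V] is first conjugated by a path in [V] from [x] to [y]. *)
Lemma small_loops_null :
  peano_continuum R X -> semilocally_simply_connected R X ->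
  forall x : X, exists2 V, nbhs x V &
    forall (y : X) (p : {path I from y to y}), (forall t, V (p t)) ->
      p ~~> path_cst y.
Proof.
move=> hX hS x; have pX := peano_path_connected hX.
have [_ _ lX _] := hX.
have [r _] := path_connected_base x pX.
have [U Ux Unull] := hS x.
have [V [oV Vx VU pV]] := lX x U Ux.
exists V; first exact: open_nbhs_nbhs.
move=> y p Vp.
have Vy : V y by have := Vp zero; rewrite path_zero.
have [m Vm] := pV x y Vx Vy.
have /Unull/(path_classP r) :
    forall t, U (path_cat (path_cat m p) (path_rev m) t).
  move=> t; apply: VU; move: t; apply: path_cat_in; last exact: path_rev_in.
  exact: path_cat_in.
rewrite !path_class_cat path_class_rev path_class_cst => e.
apply/(path_classP r); rewrite path_class_cst.
apply: (@mulgI _ (path_class r m)); apply: (@mulIg _ (path_class r m)^-1%g).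
by rewrite e mulg1 mulgV.
Qed.

Lemma good_cover (E : set (X * X)) :
  peano_continuum R X -> semilocally_simply_connected R X -> is_entourage E ->
  exists n (U : 'I_n -> set X),
    [/\ forall x, exists i, U i x,
        forall i, open (U i) /\ path_connected R (U i),
        forall i, U i `*` U i `<=` E &
        forall i j x y (p q : {path I from x to y}),
          (forall t, U i (p t)) -> (forall t, U j (q t)) -> p ~~> q].
Proof.
move=> hX hS eE; have [cX _ lX [M [h [ch [g [cg hK gK]]]]]] := hX.
have nh x (d : R) : 0 < d -> nbhs x [set z | ball (h x) d (h z)].
  by move=> d0; apply: ch; exact: nbhsx_ballx.
(* A Lebesgue number: by compactness one radius [d] makes all loops in all [d]-balls
   null-homotopic. *)
have [d d0 dnull] : exists2 d : R, 0 < d &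
    forall w y (p : {path I from y to y}),
    (forall t, ball (h w) d (h (p t))) -> p ~~> path_cst y.
  pose P (d : R) w := forall y (p : {path I from y to y}),
    (forall t, ball (h w) d (h (p t))) -> p ~~> path_cst y.
  have : \forall d \near 0^'+, [set: X] `<=` P d.
    apply: (proj1 (compact_near_coveringP _) cX) => x _.
    have [V Vx Vnull] := small_loops_null hX hS x.
    have /nbhs_ballP[e /= e0 eV] : nbhs (h x) (g @^-1` V).
      by apply: cg; rewrite hK.
    exists ([set w | ball (h x) (e / 2) (h w)], [set b | b < e / 2]).
      by split=> /=; [apply: nh|apply: nbhs_right_lt]; rewrite divr_gt0.
    move=> [w b] /= [xw be] y p wp; apply: Vnull => t.
    rewrite -(hK (p t)); apply: eV; rewrite [e]splitr.
    by apply: ball_triangle xw _; apply: le_ball (wp t); exact: ltW.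
  move=> dP; have : \forall d \near (0:R)^'+, 0 < d /\ [set: X] `<=` P d.
    by apply: filterI => //; exact: nbhs_right_gt.
  by move=> /filter_ex[d [d0 dP']]; exists d => // w; exact: dP'.
(* With radius [d / 4], two points of one cell are less than [d] apart, so two cells with a common
   point [x] lie in the [d]-ball around [x]. *)
have /choice[W WP] : forall x, exists A : set X, [/\
    open A /\ path_connected R A, A x,
    A `<=` [set z | ball (h x) (d / 4) (h z)] & A `*` A `<=` E].
  move=> x.
  have [_ [S [oS dS SE]]] := eE.
  have : nbhs (x, x) S by exact: open_nbhs_nbhs.
  move=> [[A B] /= [Ax Bx] ABS].
  have xd : nbhs x [set z | ball (h x) (d / 4) (h z)].
    by apply: nh; rewrite divr_gt0.
  have [V [oV Vx VU pV]] := lX x _ (filterI (filterI Ax Bx) xd).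
  exists V; split=> //; first by move=> z /VU[].
  by move=> [y z] /= [/VU[[Ay _] _] /VU[[_ Bz] _]]; apply/SE/ABS.
have [s sX] : exists s : seq X, forall x, exists2 y, y \in s & W y x.
  (* A finite subcover, obtained from the filter of properties shared by all sequences that contain
     some fixed finite list. *)
  pose F : set_system (seq X) :=
    [set S | exists s : seq X, forall t : seq X, {subset s <= t} -> S t].
  have FF : Filter F.
    split; first by exists [::].
      move=> S T [s sS] [t tT]; exists (s ++ t) => u stu.
      by split; [apply: sS|apply: tT] => y ys; apply: stu;
        rewrite mem_cat ys ?orbT.
    by move=> S T ST [s sS]; exists s => t /sS /ST.
  have : F [set s | [set: X] `<=` [set x | exists2 y, y \in s & W y x]].
    apply: (proj1 (compact_near_coveringP _) cX _ F
      (fun s x => exists2 y, y \in s & W y x)) => x _.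
    have [[oW _] Wx _ _] := WP x.
    exists (W x, [set s | x \in s]).
      split; first exact: open_nbhs_nbhs.
      by exists [:: x] => s; apply; rewrite inE.
    by move=> [y s] /= [xy xs]; exists x.
  by move=> [s sX]; exists s => x; exact: (sX s).
exists (size s), (fun i => W (tnth (in_tuple s) i)); split.
- move=> x; have [y ys xy] := sX x.
  have ysz : (index y s < size s)%N by rewrite index_mem.
  by exists (Ordinal ysz); rewrite (tnth_nth y) /= nth_index.
- by move=> i; case: (WP (tnth (in_tuple s) i)).
- by move=> i; case: (WP (tnth (in_tuple s) i)).
move=> i j x y p q; set a := tnth _ i; set b := tnth _ j => pU qU.
have pX := peano_path_connected hX.
have [r _] := path_connected_base x pX.
have near_x (c : X) t u : W c t -> W c u -> ball (h t) d (h u).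
  have [_ _ Wc _] := WP c; move=> /Wc ct /Wc cu.
  apply: (@le_ball _ _ _ (d / 4 + d / 4)); first by lra.
  by apply: ball_triangle cu; exact: ball_sym.
have pqnull : path_cat p (path_rev q) ~~> path_cst x.
  apply: (dnull x) => t.
  apply: (path_cat_in (U := [set u | ball (h x) d (h u)])) => u.
    by apply: (near_x a) => //; have := pU zero; rewrite path_zero.
  apply: path_rev_in => v /=.
  by apply: (near_x b) => //; have := qU zero; rewrite path_zero.
apply/(path_classP r); move/(path_classP r): pqnull.
rewrite path_class_cat path_class_rev path_class_cst => e.
by apply: (@mulIg _ (path_class r q)^-1%g); rewrite e mulgV.
Qed.

End good_covers.

Lemma continuous_compose (T V W : topologicalType) (f : T -> V) (g : V -> W) :
  continuous f -> continuous g -> continuous (fun t => g (f t)).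
Proof.
by move=> cf cg t; apply: (@continuous_comp _ _ _ f g); [exact: cf|exact: cg].
Qed.

(** * Replacing a path by a chain of cells *)

Section path_subdivision.
Context {R : realType} {X : topologicalType} {x0 : X}.
Local Notation I := (unit_interval R).
Local Notation "p ~~> q" := (path_homotopic p q) (at level 70).
Variable r : forall x : X, {path I from x0 to x}.

(** Both sides are [f] after a parameter function going from [0] to [b], so a straight-line homotopy
    of parameters applies. The numbers [a] and [b] come in either order, since [path_cell_chain]
    steps in both directions. *)
Lemma affine_reparam_cat (f : I -> X) (x y z : X) (a b : R)
    (p : {path I from x to z}) (q : {path I from x to y})
    (m : {path I from y to z}) : continuous f ->
  p =1 (fun t => f (clip (b * uval t))) ->
  q =1 (fun t => f (clip (a * uval t))) ->
  m =1 (fun t => f (clip ((b - a) * uval t + a))) ->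
  p ~~> path_cat q m.
Proof.
move=> cf pE qE mE.
pose psi (s : I) : R := if uval s <= 2^-1
  then a * uval (clip (2 * uval s + 0) : I) + 0
  else (b - a) * uval (clip (2 * uval s - 1) : I) + a.
have cu (c d : R) : continuous (fun s : I => uval (clip (c * uval s + d) : I)).
  apply: continuous_compose; last exact: uval_continuous.
  apply: continuous_compose; last exact: clip_continuous.
  exact/affine_continuous/uval_continuous.
have -> : (p : I -> X) = f \o clip \o (fun s => b * uval s + 0).
  by apply/funext => s; rewrite pE /= addr0.
have -> : (path_cat q m : I -> X) = f \o clip \o psi.
  apply/funext => s; rewrite path_catE /= /psi.
  by case: ifP => _; rewrite ?qE ?mE ?addr0.
apply: path_homotopic_reparam => //.
- exact/affine_continuous/uval_continuous.
- apply: (@paste_continuous R).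
  + exact: uval_continuous.
  + exact/affine_continuous/cu.
  + exact/affine_continuous/cu.
  + move=> s ->; rewrite clip_ge1; last by lra.
    by rewrite clip_le0 ?uval0 ?uval1; lra.
- rewrite /psi uval0 ifT; last by lra.
  by rewrite clip_le0 ?uval0; lra.
- rewrite /psi uval1 ifF; last by lra.
  by rewrite clip_ge1 ?uval1; lra.
Qed.

Variables (n : nat) (U : 'I_n -> set X) (e : X -> X -> pi1 R x0).
Hypothesis Ucover : forall x, exists i, U i x.
Hypothesis Uopen : forall i, open (U i).
Hypothesis eP : forall i x y (p : {path I from x to y}),
  (forall t, U i (p t)) -> e x y = path_class r p.

(** The parameters up to which [p] can be replaced by a cell chain form an open and closed set:
    between nearby parameters [p] stays in one cell, and one more point is appended. *)
Lemma path_cell_chain (x y : X) (p : {path I from x to y}) :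
  exists s, [/\ echain (cell_rel U) x s, last x s = y &
    chain_prod e x s = path_class r p].
Proof.
(* The piece of [p] up to [b] is any path pointwise equal to it, since its endpoint is part of its
   type. *)
pose P (b : R) := forall z (q : {path I from x to z}),
  q =1 (fun t => p (clip (b * uval t))) ->
  exists s, [/\ echain (cell_rel U) x s, last x s = z &
    chain_prod e x s = path_class r q].
have cp : continuous p by exact: cts_fun.
have cpa (a b : R) : continuous (fun t : I => p (clip (a * uval t + b))).
  apply: continuous_compose; last exact: cp.
  apply: continuous_compose; last exact: clip_continuous.
  exact/affine_continuous/uval_continuous.
have step i (a b : R) :
    (forall t : I, U i (p (clip ((b - a) * uval t + a)))) -> P a -> P b.
  move=> Uab Pa z q qE.
  have a0 : p (clip (a * uval (zero : I) + 0)) = x.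
    by rewrite uval0 mulr0 addr0 clip_le0 ?path_zero.
  have a1 : p (clip (a * uval (one : I) + 0)) = p (clip a).
    by rewrite uval1 mulr1 addr0.
  have b0 : p (clip ((b - a) * uval (zero : I) + a)) = p (clip a).
    by rewrite uval0 mulr0 add0r.
  have b1 : p (clip ((b - a) * uval (one : I) + a)) = z.
    by rewrite uval1 mulr1 subrK -(path_one (s:=q)) qE uval1 mulr1.
  pose qa : {path I from x to p (clip a)} := mk_path (cpa a 0) a0 a1.
  pose m : {path I from p (clip a) to z} := mk_path (cpa (b - a) a) b0 b1.
  have [t|s [xs ls es]] := Pa _ qa; first by rewrite /= /mk_path addr0.
  exists (s ++ [:: z]); split.
  - rewrite echain_cat xs /= andbT ls inE; exists i => /=.
    by split; [rewrite -b0|rewrite -b1].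
  - by rewrite last_cat.
  - have qm : path_class r q = path_class r (path_cat qa m).
      apply/path_classP; apply: (affine_reparam_cat cp qE) => // t.
      by rewrite /= /mk_path addr0.
    rewrite qm chain_prod_cat path_class_cat es /= mulg1 ls.
    by rewrite (eP (i := i) (p := m)).
have P0 : P 0.
  move=> z q qE.
  have q0 t : q t = x by rewrite qE mul0r clip_le0 // path_zero.
  have zx : z = x by rewrite -(q0 one) path_one.
  subst z; exists [::]; split=> //=.
  rewrite -(path_class_cst r x); apply/esym/path_classP.
  by apply: path_homotopic_same => //; exact: cts_fun.
pose PI (t : I) := P (uval t).
suff : PI one by apply=> t; rewrite uval1 mul1r uvalK.
apply: (connected_locally_constant (P := PI) (@unit_interval_connected R))
  (_ : PI zero); last by rewrite /PI uval0.
move=> t; have [i ti] := Ucover (p t).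
have : nbhs (uval t) ((p \o clip) @^-1` (U i)).
  apply: (continuous_compose (@clip_continuous R) cp).
  by apply: open_nbhs_nbhs; rewrite uvalK.
move=> /nbhs_ballP[d /= d0 dU].
have : nbhs t (uval @^-1` (ball (uval t) d)).
  by apply: uval_continuous; exact: nbhsx_ballx.
apply: filterS => u /=; rewrite /ball /= => tu.
have Utu (v : R) : 0 <= v <= 1 -> `|(uval t - uval u) * v| < d.
  move=> /andP[v0 v1]; rewrite normrM (ger0_norm v0).
  by apply: le_lt_trans tu; rewrite ler_piMr.
split; apply: (step i) => v; apply: dU; rewrite /ball /=.
- rewrite (_ : _ - _ = (uval t - uval u) * (1 - uval v)); last by lra.
  by apply: Utu; have := uval_itv v; lra.
- rewrite (_ : _ - _ = (uval t - uval u) * uval v); last by lra.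
  exact: Utu (uval_itv v).
Qed.

End path_subdivision.

(** * Lifting chains to the entourage cover *)

Section entourage_covers.
Variables (X : topologicalType) (E : entourage_of X) (x0 : X).
Let eE := entourageP E.

(** Prepending [s] or its reversal cancels the other. The condition in [entourage_star] thus becomes
    that [t] is [s] extended by one point. *)
Lemma echain_homotopic_moveV (s t : seq X) (y : X) :
  echain E x0 s -> echain E x0 t -> (E : set (X * X)) (last x0 s, y) ->
  echain_homotopic E (last x0 s) (rev (belast x0 s) ++ t) [:: y] <->
  echain_homotopic E x0 t (s ++ [:: y]).
Proof.
move=> xs xt sy; pose s' := rev (belast x0 s).
have xs' : echain E (last x0 s) s' by exact: (echain_rev eE).
split=> h.
  apply: (echain_homotopic_trans (t := s ++ s' ++ t)).
    apply: echain_homotopic_sym; rewrite catA.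
    apply: (@echain_homotopic_catr _ _ _ _ [::]) (echain_homotopic_catV eE xs).
    by rewrite last_cat last_rev_belast.
  exact: echain_homotopic_catl.
apply: (echain_homotopic_trans (t := s' ++ s ++ [:: y])).
  by apply: echain_homotopic_catl => //; rewrite last_rev_belast.
rewrite catA.
apply: (@echain_homotopic_catr _ _ _ _ [::]) (echain_homotopic_catVl eE xs).
by rewrite last_cat !last_rev_belast; exact/echain1.
Qed.

(** A relation between bare sequences and classes, which keeps the proofs of [echain] out of the
    statements. *)
Definition chain_class (s : seq X) (c : entourage_space E x0) : Prop :=
  exists2 t : based_echain E x0, val t = s & c = \pi_(entourage_space E x0) t.

Lemma chain_class_ex c : exists s, chain_class s c.
Proof. by exists (val (repr c)); exists (repr c); rewrite ?reprK. Qed.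

Lemma chain_class_echain s c : chain_class s c -> echain E x0 s.
Proof. by move=> [t <- _]; exact: valP. Qed.

Lemma chain_class_last s c :
  chain_class s c -> entourage_map E x0 c = last x0 s.
Proof. by move=> [t <- ->]; rewrite entourage_mapE. Qed.

Lemma chain_classP s t c d : chain_class s c -> chain_class t d ->
  c = d <-> echain_homotopic E x0 s t.
Proof. by move=> [s' <- ->] [t' <- ->]; exact: entourage_spaceP. Qed.

Lemma chain_class_homotopic s t c : chain_class s c ->
  echain_homotopic E x0 s t -> chain_class t c.
Proof.
move=> [s' <- ->] st; have xt : echain E x0 t.
  by rewrite -(echain_homotopic_echain st); exact: valP.
exists (exist _ t xt) => //; exact/entourage_spaceP.
Qed.

Lemma entourage_starP (F : set (X * X)) s c d : F `<=` E -> chain_class s c ->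
  entourage_star F (c, d) <->
  exists2 y, F (last x0 s, y) & chain_class (s ++ [:: y]) d.
Proof.
move=> FE sc; have xs := chain_class_echain sc; split.
  move=> [s' [t [[cs' dt] Fst h]]].
  have s's : echain_homotopic E x0 (val s') s.
    by apply/(chain_classP _ sc); [exists s'|exact: esym].
  exists (last x0 (val t)); first by rewrite -(echain_homotopic_last s's).
  apply: (@chain_class_homotopic (val t)); first by exists t.
  have /(echain_homotopic_moveV (valP s') (valP t) (FE _ Fst)) h' := h.
  apply: echain_homotopic_trans h' _.
  apply: echain_homotopic_catr => //; exact/echain1/FE.
move=> [y Fy [t ty ->]]; case: sc xs Fy ty => s' <- -> xs Fy ty.
exists s', t; rewrite ty last_cat /=; split=> //.
apply/(echain_homotopic_moveV xs _ (FE _ Fy));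
  last exact: echain_homotopic_refl.
by rewrite -ty; exact: valP.
Qed.

Lemma entourage_space_openP (A : set (entourage_space E x0)) :
  open A <-> entourage_space_open A.
Proof. by []. Qed.

(* The ball of this entourage at [y] is [V]. *)
Lemma point_entourage (y : X) (V : set X) : open V -> V y ->
  (forall z, z != y -> nbhs z [set z' | z' != y]) ->
  is_entourage [set uv | (V uv.1 /\ V uv.2) \/ (uv.1 != y /\ uv.2 != y)].
Proof.
move=> oV Vy T1; split.
  by move=> u v /= [[]|[]]; [left|right].
eexists; split; last exact: subset_refl.
  rewrite openE => -[u v] /= [[Vu Vv]|[uy vy]].
    exists (V, V); first by split; exact: open_nbhs_nbhs.
    by move=> [u' v'] [/= ? ?]; left.
  exists ([set z | z != y], [set z | z != y]); first by split; exact: T1.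
  by move=> [u' v'] [/= ? ?]; right.
by move=> x /=; have [->|] := eqVneq x y; [left|right].
Qed.

(** Balls need not be open, so [E] is shrunk to an open symmetric entourage [F], whose ball around
    [c] is open. *)
Lemma entourage_star_nbhs (c : entourage_space E x0) :
  (forall y z : X, z != y -> nbhs z [set z' | z' != y]) ->
  exists A : set (entourage_space E x0),
    [/\ open A, A c & forall d, A d -> entourage_star E (c, d)].
Proof.
move=> T1; have [sE [W [oW dW WE]]] := eE.
pose F := W `&` [set xy | W (xy.2, xy.1)].
have FE : F `<=` E by move=> xy [/WE].
have oF : open F.
  apply: openI => //.
  apply: (@open_comp _ _ (fun xy : X * X => (xy.2, xy.1))) => // xy _.
  by apply: cvg_pair; [exact: cvg_snd|exact: cvg_fst].
have [s sc] := chain_class_ex c.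
exists [set d | entourage_star F (c, d)]; split.
- apply/entourage_space_openP => d /= /(entourage_starP _ FE sc)[y Fy yd].
  pose V := [set v | F (last x0 s, v)].
  have oV : open V.
    apply: (@open_comp _ _ (fun v => (last x0 s, v))) => // v _.
    by apply: cvg_pair; [exact: cvg_cst|exact: cvg_id].
  (* The second factor forces a neighbour [z] of [y] into [V], that is, [F]-close to [last x0 s];
     then [y] can be deleted between [last x0 s] and [z]. *)
  exists (F `&` [set uv | (V uv.1 /\ V uv.2) \/ (uv.1 != y /\ uv.2 != y)]).
  split.
  + apply: is_entourageI (point_entourage oV Fy (T1 y)).
    split; first by move=> u v [].
    by exists F; split=> // x; split; exact: dW.
  + by move=> uv [/FE].
  have GE : F `&` [set uv | (V uv.1 /\ V uv.2) \/ (uv.1 != y /\ uv.2 != y)]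
    `<=` E by move=> uv [/FE].
  move=> d' /xsectionP /(entourage_starP _ GE yd)[z].
  rewrite last_cat /= => -[Fyz /= [[_ Vz]|[]]]; last by rewrite eqxx.
  move=> h; apply/(entourage_starP _ FE sc); exists z => //.
  apply: chain_class_homotopic h _; rewrite -catA /=.
  apply: echain_homotopic_catl; first exact: chain_class_echain sc.
  by apply/echain_homotopic_sym/(echain_homotopic_insert); exact: FE.
- apply/(entourage_starP _ FE sc).
  exists (last x0 s); first by split; exact: dW.
  apply: chain_class_homotopic (sc) _.
  rewrite -[X in echain_homotopic _ _ X]cats0.
  apply: echain_homotopic_catl; first exact: chain_class_echain sc.
  exact: (echain_homotopic_cst eE).
- by move=> d /(entourage_starS FE).
Qed.

End entourage_covers.

(** * The fibre of the orbit space over the basepoint *)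

Section cover_fibre.
Variables (R : realType) (X : topologicalType) (x0 : X) (N : set (pi1 R x0)).
Hypothesis nN : normal_subgroup N.
Local Notation I := (unit_interval R).

Definition cover_point (y : X) (p : {path I from x0 to y}) : orbit_space N :=
  \pi_(orbit_space N) (\pi_(universal_cover R x0) (Based p)).

Lemma cover_point_homotopic (y : X) (p q : {path I from x0 to y}) :
  path_homotopic p q -> cover_point p = cover_point q.
Proof.
by move=> pq; congr (\pi_(orbit_space N) _); exact/universal_coverP.
Qed.

Lemma cover_of_point (y : X) (p : {path I from x0 to y}) :
  cover_of N (cover_point p) = y.
Proof. by have [N1 _ _ _] := nN; rewrite cover_ofE // endpointE. Qed.

Lemma orbit_spaceP (a b : universal_cover R x0) :
  \pi_(orbit_space N) a = \pi_(orbit_space N) b <->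
  deck_orbit N a = deck_orbit N b.
Proof.
change (\pi_({eq_quot orbit_equiv N}) a = \pi_({eq_quot orbit_equiv N}) b <->
  deck_orbit N a = deck_orbit N b).
by split=> [/eqP|h]; [|apply/eqP]; rewrite piE => *; exact/asboolP.
Qed.

(** Over [x0] the universal cover is a copy of [pi1] on which the deck action is left
    multiplication, so the [N]-orbits there are the cosets [N a]. *)
Lemma cover_point_loop (p : {path I from x0 to x0}) :
  cover_point p = cover_point (path_cst x0) <-> N (\pi_(pi1 R x0) p).
Proof.
have [N1 NM NV _] := nN.
pose base (a : pi1 R x0) := \pi_(universal_cover R x0) (Based (repr a)).
have baseE q : \pi_(universal_cover R x0) (Based q) = base (\pi_(pi1 R x0) q).
  exact/universal_coverP/path_homotopic_sym/pi1_reprK.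
have base_inj : injective base.
  by move=> a b /universal_coverP/pi1P; rewrite !reprK.
have act g a : deck_act g (base a) = base (g * a)%g.
  by rewrite -[g in LHS]reprK deck_actE baseE.
rewrite /cover_point !baseE -[\pi_(pi1 R x0) (path_cst x0)]/(1%g : pi1 R x0).
set a := \pi_(pi1 R x0) p.
have orbE b : deck_orbit N (base b) = [set base (g * b)%g | g in N].
  by apply/seteqP; split=> _ [g Ng <-]; exists g.
rewrite orbit_spaceP !orbE; split=> [ab|Na].
  have : [set base (g * 1)%g | g in N] (base (1 * a)%g).
    by rewrite -ab; exists 1%g.
  by move=> [g Ng /base_inj]; rewrite mulg1 mul1g => <-.
apply/seteqP; split=> _ [g Ng <-].
  by exists (g * a)%g; rewrite ?mulg1//; exact: NM.
exists (g * a^-1)%g; first by apply: NM => //; exact: NV.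
by rewrite mulgVK mulg1.
Qed.

End cover_fibre.

(** * Lifting paths through the equivalence of covers *)

Section lifting.
Variables (R : realType) (X : topologicalType) (x0 : X) (N : set (pi1 R x0)).
Hypothesis nN : normal_subgroup N.
Local Notation I := (unit_interval R).
Local Notation "p ~~> q" := (path_homotopic p q) (at level 70).
Variable E : entourage_of X.
Hypothesis T1 : forall y z : X, z != y -> nbhs z [set z' | z' != y].
Hypothesis lX : locally_path_connected R X.

Variable h : orbit_space N -> entourage_space E x0.
Hypothesis hC : continuous h.
Hypothesis h_inj : injective h.
Hypothesis hE : forall c, entourage_map E x0 (h c) = cover_of N c.

Variables (n : nat) (U : 'I_n -> set X).
Hypothesis Uopen : forall i, open (U i).
Hypothesis Uconn : forall i, path_connected R (U i).
Hypothesis UE : forall i, U i `*` U i `<=` E.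
Hypothesis Uhomotopic : forall i j x y (p q : {path I from x to y}),
  (forall t, U i (p t)) -> (forall t, U j (q t)) -> p ~~> q.

Definition lift (y : X) (p : {path I from x0 to y}) : entourage_space E x0 :=
  h (cover_point N p).

Lemma lift_last s y (p : {path I from x0 to y}) :
  chain_class s (lift p) -> last x0 s = y.
Proof. by move/chain_class_last; rewrite hE cover_of_point. Qed.

(** Continuity of [h] pulls the open set of [entourage_star_nbhs] back to a whisker neighbourhood;
    compatibility with the projections identifies the appended point as [z]. *)
Lemma lift_nbhs y (p : {path I from x0 to y}) s : chain_class s (lift p) ->
  exists V, [/\ open V, V y & forall z (m : {path I from y to z}),
    (forall t, V (m t)) -> chain_class (s ++ [:: z]) (lift (path_cat p m))].
Proof.
move=> sp; have [A [oA Ap AE]] := entourage_star_nbhs (lift p) T1.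
pose f (a : universal_cover R x0) := h (\pi_(orbit_space N) a).
have cf : continuous f.
  apply: continuous_compose hC; exact: pi_continuous.
have /(_ _ Ap)[V [oV Vp VA]] : universal_cover_open (f @^-1` A).
  exact: (open_comp (fun a _ => cf a) oA).
exists V; split=> //; first by rewrite endpointE in Vp.
move=> z m Vm.
have /AE/(entourage_starP _ (@subset_refl _ E) sp)[z' _ h'] :
    A (lift (path_cat p m)).
  by apply: VA; exists y, z, p, m.
by have := lift_last h'; rewrite last_cat /= => zz'; rewrite zz' in h'.
Qed.

(** The set [V] of [lift_nbhs] depends on the path, whereas the cell is given in advance;
    connectedness of the interval carries the local statement along [q]. *)
Lemma lift_cell i x y (p : {path I from x0 to x}) (q : {path I from x to y}) s :
  (forall t, U i (q t)) -> chain_class s (lift p) ->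
  chain_class (s ++ [:: y]) (lift (path_cat p q)).
Proof.
move=> Uq sp; have sx := lift_last sp; have xs := chain_class_echain sp.
have Ux : U i x by have := Uq zero; rewrite path_zero.
have UEi u v : U i u -> U i v -> (E : set (X * X)) (u, v).
  by move=> Uu Uv; apply: (@UE i (u, v)).
have lift_eq z (m m' : {path I from x to z}) :
    (forall t, U i (m t)) -> (forall t, U i (m' t)) ->
    lift (path_cat p m) = lift (path_cat p m').
  move=> Um Um'; congr h; apply: cover_point_homotopic.
  by apply: path_cat_homotopic; [exact: path_refl|exact: (Uhomotopic Um Um')].
pose P z := forall m : {path I from x to z}, (forall t, U i (m t)) ->
  chain_class (s ++ [:: z]) (lift (path_cat p m)).
suff : P y by apply.
pose PI (t : I) := P (q t).
suff: PI one by rewrite /PI path_one.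
apply: (connected_locally_constant (P := PI) (@unit_interval_connected R))
  (_ : PI zero); last first.
  rewrite /PI path_zero => m Um.
  have -> : lift (path_cat p m) = lift p.
    rewrite (@lift_eq _ m (path_cst x)) //; congr h.
    exact/cover_point_homotopic/path_catp1.
  apply: (chain_class_homotopic sp).
  rewrite -[X in echain_homotopic _ _ X]cats0.
  apply: echain_homotopic_catl => //; rewrite sx.
  exact: echain_homotopic_cst (entourageP E) _.
move=> t; have Uqt := Uq t.
have [m Um] := Uconn Ux Uqt.
have [s1 s1m] := chain_class_ex (lift (path_cat p m)).
have [V [oV Vqt VP]] := lift_nbhs s1m.
have [W [oW Wqt WVU pW]] : exists W, [/\ open W, W (q t), W `<=` V `&` U i &
    path_connected R W].
  by apply: lX; apply: filterI; apply: open_nbhs_nbhs.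
have : nbhs t (q @^-1` W).
  by apply: (@cts_fun _ _ q); exact: open_nbhs_nbhs.
apply: filterS => t' /= Wqt'.
have [k Wk] := pW _ _ Wqt Wqt'.
have Uk v : U i (k v) by case: (WVU _ (Wk v)).
have Uqt' := Uq t'.
have Umk : forall v, U i (path_cat m k v) by exact: path_cat_in.
have s1t' : chain_class (s1 ++ [:: q t']) (lift (path_cat p (path_cat m k))).
  have -> : lift (path_cat p (path_cat m k)) = lift (path_cat (path_cat p m) k).
    by congr h; apply/cover_point_homotopic/path_catA.
  by apply: VP => v; case: (WVU _ (Wk v)).
have s1x := lift_last s1m.
have xs1 := chain_class_echain s1m.
have sqt : echain E x0 (s ++ [:: q t]).
  by rewrite echain_cat xs sx; apply/echain1/UEi.
have move_end :
    echain_homotopic E x0 (s ++ [:: q t']) ((s ++ [:: q t]) ++ [:: q t']).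
  rewrite -catA; apply: echain_homotopic_catl => //; rewrite sx /=.
  by apply: echain_homotopic_insert; exact: UEi.
split=> Pt m' Um'.
(* From [t'] back to [t]: two chains for the lift at [q t'] end in the same step, which is
   cancelled. *)
- have Pm := Pt _ Umk; rewrite (lift_eq _ _ _ Um' Um).
  apply: (chain_class_homotopic s1m).
  apply: (echain_homotopic_cancelr (entourageP E) (u := [:: q t'])) => //.
  + by rewrite s1x; exact/echain1/UEi.
  + by rewrite s1x last_cat.
  + apply: echain_homotopic_trans move_end.
    exact/(chain_classP s1t' Pm).
- rewrite (lift_eq _ _ _ Um' Umk); apply: (chain_class_homotopic s1t').
  apply: echain_homotopic_trans (echain_homotopic_sym move_end).
  apply: echain_homotopic_catr; first by rewrite s1x; exact/echain1/UEi.
  exact/(chain_classP s1m (Pt _ Um)).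
Qed.

Variable r : forall x : X, {path I from x0 to x}.
Hypothesis r0 : r x0 ~~> path_cst x0.
Variable e : X -> X -> pi1 R x0.
Hypothesis eP : forall i x y (p : {path I from x to y}),
  (forall t, U i (p t)) -> e x y = path_class r p.

Lemma lift_chain x y (p : {path I from x0 to x}) a s :
  echain (cell_rel U) x s -> last x s = y -> chain_class a (lift p) ->
  exists q : {path I from x to y},
    path_class r q = chain_prod e x s /\
    chain_class (a ++ s) (lift (path_cat p q)).
Proof.
elim: s x p a => [|z s IHs] x p a.
  move=> _ /= <- ap; exists (path_cst x).
  rewrite path_class_cst cats0; split=> //.
  rewrite (_ : lift _ = lift p) //; congr h.
  exact/cover_point_homotopic/path_catp1.
rewrite /echain /= => /andP[]; rewrite inE => -[i [/= xi zi]] zs lzs ap.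
have [m Um] := Uconn xi zi.
have [q [qE qs]] := IHs z (path_cat p m) _ zs lzs (lift_cell Um ap).
exists (path_cat m q); rewrite path_class_cat qE (eP Um); split=> //.
rewrite -cat1s catA (_ : lift _ = lift (path_cat (path_cat p m) q)) //.
congr h; exact/cover_point_homotopic/path_catA.
Qed.

(** A path [q] following [s] has class in [N] exactly when it ends at the same point of the orbit
    space as the constant path; injectivity of [h] moves this equality to classes of chains. *)
Lemma loop_null s : echain (cell_rel U) x0 s -> last x0 s = x0 ->
  N (chain_prod e x0 s) <-> echain_homotopic E x0 s [::].
Proof.
move=> xs ls.
(* Nothing makes [h] match basepoints, so the constant path lifts to the class of some chain [a],
   cancelled on the left at the end. *)
have [a ap] := chain_class_ex (lift (path_cst x0)).
have [q [qE aq]] := lift_chain xs ls ap.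
have {aq} aq : chain_class (a ++ s) (lift q).
  rewrite (_ : lift q = lift (path_cat (path_cst x0) q)) //; congr h.
  exact/cover_point_homotopic/path_homotopic_sym/path_cat1p.
have xa := chain_class_echain ap; have la := lift_last ap.
rewrite -qE path_class_loop // -cover_point_loop //.
have -> : cover_point N q = cover_point N (path_cst x0) <->
    lift q = lift (path_cst x0).
  by split=> [|/h_inj //]; rewrite /lift => ->.
rewrite (chain_classP aq ap); split=> [|h'].
  rewrite -[X in echain_homotopic _ _ _ X]cats0.
  rewrite -[X in echain_homotopic _ X s]la.
  apply: echain_homotopic_cancell => //; first exact: entourageP.
  by have := chain_class_echain aq; rewrite echain_cat => /andP[].
rewrite -[X in echain_homotopic _ _ _ X]cats0.
by apply: echain_homotopic_catl => //; rewrite la.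
Qed.

End lifting.

(** * Finite normal generation *)

Lemma cell_rel_entourage (n : nat) (X : topologicalType) (U : 'I_n -> set X) :
  (forall x, exists i, U i x) -> (forall i, open (U i)) ->
  is_entourage (cell_rel U).
Proof.
move=> Ucover Uopen; split; first by move=> x y [i []]; exists i.
exists (cell_rel U); split=> [|x|//]; last by have [i] := Ucover x; exists i.
rewrite openE => -[x y] [i /= [xi yi]].
exists (U i, U i).
  by split; apply: open_nbhs_nbhs; split=> //; exact: Uopen.
by move=> [u v] [/= ? ?]; exists i.
Qed.

Section finiteness.
Variables (X : topologicalType) (E : set (X * X)) (x0 : X).
Hypothesis eE : is_entourage E.
Hypothesis chE : chained E.
Variables (n : nat) (U : 'I_n -> set X).
Hypothesis Ucover : forall x, exists i, U i x.
Hypothesis Uopen : forall i, open (U i).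
Hypothesis UE : forall i, U i `*` U i `<=` E.
Variables (G : groupType) (e : X -> X -> G).
Hypothesis e_cocycle : forall i x y z,
  U i x -> U i y -> U i z -> (e x y * e y z)%g = e x z.

Lemma cell_rel_sub : cell_rel U `<=` E.
Proof. by move=> [x y] [i xyi]; exact: (@UE i). Qed.

Lemma echain_cell x s : echain (cell_rel U) x s -> echain E x s.
Proof. by apply: sub_path => y z; rewrite !inE => /cell_rel_sub. Qed.

Lemma short_cell_chain_homotopic x y : E (x, y) -> exists t,
  [/\ echain (cell_rel U) x t, last x t = y, (size t <= n)%N &
      echain_homotopic E x t [:: y]].
Proof.
move=> xy; have [_ /(_ _ _ xy)] := chE.
move=> /(_ _ (cell_rel_entourage Ucover Uopen))[s [xs ls sB]].
have [t [xt lt tB /andP[t0 tn]]] := short_cell_chain Ucover xs sB.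
exists t; rewrite lt ls; split=> //.
rewrite -[y in [:: y]]ls -lt; apply: echain_homotopic_star.
- exact: echain_cell.
- by rewrite -size_eq0 -lt0n.
- by move=> z /tB[/xsectionP].
Qed.

Variable N : set G.
Hypothesis nN : normal_subgroup N.
Hypothesis null_loop : forall z s, echain (cell_rel U) z s -> last z s = z ->
  echain_homotopic E z s [::] -> N (chain_prod e z s).
Hypothesis N_loop : forall g, N g -> exists s, [/\ echain (cell_rel U) x0 s,
  echain_homotopic E x0 s [::] & g = chain_prod e x0 s].

Lemma finite_normal_generation :
  exists A : set G, finite_set A /\ N = normal_closure A.
Proof.
(* Triangles give loops of length at most [3 * n] and cell edges of at most [n + 1]; the bound
   covers both for every [n]. *)
have [A [fA AN Asmall]] := finite_loop_products e_cocycle (3 * n).+1 nN.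
exists A; split=> //; set M := normal_closure A.
have nM : normal_subgroup M by exact: normal_closure_normal.
have [M1 _ _ _] := nM.
have Mrefl a : M (a * a^-1)%g by rewrite mulgV.
(* The loop [s] followed by the reversal of [t] is [E]-null and short, so its product lies in [N]
   and hence in [M]. *)
have close x s t : echain (cell_rel U) x s -> echain (cell_rel U) x t ->
    echain_homotopic E x s t -> (size s + size t <= (3 * n).+1)%N ->
    M (chain_prod e x s * (chain_prod e x t)^-1)%g.
  move=> xs xt st szst; have lst := echain_homotopic_last st.
  have xs' : echain (cell_rel U) x (s ++ rev (belast x t)).
    rewrite echain_cat xs lst.
    exact: (echain_rev (cell_rel_entourage Ucover Uopen) xt).
  have ls' : last x (s ++ rev (belast x t)) = x.
    by rewrite last_cat lst last_rev_belast.
  rewrite -(chain_prod_rev e_cocycle xt) -lst -chain_prod_cat.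
  apply: Asmall => //; first by rewrite size_cat size_rev size_belast.
  apply: null_loop => //.
  apply: echain_homotopic_trans (echain_homotopic_catV eE (echain_cell xt)).
  apply: echain_homotopic_catr => //; rewrite lst.
  exact/(echain_rev eE)/echain_cell.
(* Short cell chains [Q] extend the product from cell chains to all [E]-chains, through [q]; off [E]
   the value is the empty chain. *)
have /choice[Q QP] : forall xy : X * X, exists t, E xy ->
    [/\ echain (cell_rel U) xy.1 t, last xy.1 t = xy.2, (size t <= n)%N &
        echain_homotopic E xy.1 t [:: xy.2]].
  move=> [x y].
  have [/short_cell_chain_homotopic[t tP]|nxy] := pselect (E (x, y)).
    by exists t.
  by exists [::] => /nxy.
pose q x y := chain_prod e x (Q (x, y)).
have triangle x y z : E (x, y) -> E (y, z) -> E (x, z) ->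
    M (q x y * q y z * (q x z)^-1)%g.
  move=> xy yz xz; rewrite /q.
  have [/= c1 l1 s1 h1] := QP _ xy; have [/= c2 l2 s2 h2] := QP _ yz.
  have [/= c3 l3 s3 h3] := QP _ xz.
  have -> : (chain_prod e x (Q (x, y)) * chain_prod e y (Q (y, z)))%g =
      chain_prod e x (Q (x, y) ++ Q (y, z)) by rewrite chain_prod_cat l1.
  apply: close => //; first by rewrite echain_cat c1 l1.
    apply: echain_homotopic_trans (echain_homotopic_sym h3).
    apply: (echain_homotopic_trans (t := [:: y] ++ Q (y, z))).
      by apply: echain_homotopic_catr => //; rewrite l1; exact: echain_cell.
    apply: (echain_homotopic_trans (t := [:: y] ++ [:: z])).
      by apply: echain_homotopic_catl => //; exact/echain1.
    exact/echain_homotopic_sym/echain_homotopic_insert.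
  rewrite size_cat -addnA leqW // !mulSn mul0n addn0.
  by rewrite leq_add // leq_add.
have const x : M (q x x).
  have [/= c l s h] := QP _ (is_entourage_refl eE x).
  have := @close x (Q (x, x)) [::] c isT; rewrite /= invg1 mulg1; apply.
    apply: echain_homotopic_trans h _.
    exact: echain_homotopic_sym (echain_homotopic_cst eE x).
  by rewrite addn0 leqW // (leq_trans s) // leq_pmull.
have edge x y : cell_rel U (x, y) -> M (e x y * (q x y)^-1)%g.
  move=> Fxy; have [/= c l s h] := QP _ (cell_rel_sub Fxy).
  have := @close x [:: y] (Q (x, y)); rewrite /= mulg1; apply=> //.
  - by rewrite /echain /= andbT inE.
  - exact: echain_homotopic_sym.
  - by rewrite add1n ltnS (leq_trans s) // leq_pmull.
have edges x s : echain (cell_rel U) x s ->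
    M (chain_prod e x s * (chain_prod q x s)^-1)%g.
  elim: s x => [|y s IHs] x; first by rewrite /= mulgV.
  rewrite /echain /= => /andP[]; rewrite inE => xy ys.
  by apply: (normal_subgroup_div_mul nM); [exact: edge|exact: IHs].
(* Modulo [M], inserting a point is a [triangle] and the convention {x, x} = {x} is [const]. *)
have invariant s t : echain_homotopic E x0 s t ->
    M (chain_prod q x0 s * (chain_prod q x0 t)^-1)%g.
  elim=> {s t} [s t st|s|s t _|s u t _ + _]; first last.
  - exact: normal_subgroup_div_trans.
  - exact: normal_subgroup_divC.
  - exact: Mrefl.
  case: st => [s1 y [//|z s2] _|].
    rewrite !echain_cat => /andP[_ /echain_consP[xz zs]].
    move=> /andP[_ /echain_consP[xy /echain_consP[yz _]]].
    rewrite !chain_prod_cat; apply: (normal_subgroup_div_mul nM) => //=.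
    rewrite [(q _ y * _)%g]mulgA; apply: (normal_subgroup_div_mul nM) => //.
    by apply: (normal_subgroup_divC nM); exact: triangle.
  by move=> _ /=; rewrite mulg1 mul1g; case: nM => _ _ + _; apply; exact: const.
apply/seteqP; split=> [g /N_loop[s [xs s0 ->]]|g].
  have := normal_subgroup_div_trans nM (edges _ _ xs) (invariant _ _ s0).
  by rewrite /= invg1 mulg1.
(* [N] is itself one of the normal subgroups containing [A] that are intersected in [M]. *)
by apply.
Qed.

End finiteness.

Theorem theorem5 (R : realType) (X : topologicalType) (x0 : X)
    (hX : peano_continuum R X) (hS : semilocally_simply_connected R X)
    (N : set (pi1 R x0)) (hN : normal_subgroup N)
    (hE : exists E : entourage_of X,
        chained E /\ equivalent_covers (cover_of N) (entourage_map E x0)) :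
  exists A : set (pi1 R x0), finite_set A /\ N = normal_closure A.
Proof.
have [E [chE [h [[hC [g [_ hK _]]] hh]]]] := hE.
have eE := entourageP E; have [_ _ lX mX] := hX.
have [n [U [Ucover Uoc UE Uhom]]] := good_cover hX hS eE.
have Uopen i : open (U i) by case: (Uoc i).
have Uconn i : path_connected R (U i) by case: (Uoc i).
have T1 (y z : X) : z != y -> nbhs z [set z' | z' != y].
  by apply: (metrizable_accessible mX).
have [r r0] := path_connected_base x0 (peano_path_connected hX).
(* [Uhom] makes the class independent of the path and of the cell; where no cell contains a path
   from [x] to [y] the value is [1]. *)
have [e eP] : exists e : X -> X -> pi1 R x0, forall i x y
    (p : {path unit_interval R from x to y}),
    (forall t, U i (p t)) -> e x y = path_class r p.
  have : forall xy : X * X, exists a, forall i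
      (p : {path unit_interval R from xy.1 to xy.2}),
      (forall t, U i (p t)) -> a = path_class r p.
    move=> [x y]; have [[i [p Up]]|np] := pselect (exists i
      (p : {path unit_interval R from x to y}), forall t, U i (p t)).
      exists (path_class r p) => j q Uq.
      by apply/path_classP/Uhom; [exact: Up|exact: Uq].
    by exists 1%g => i p Up; case: np; exists i, p.
  move=> /choice[e eP]; exists (fun x y => e (x, y)) => i x y.
  exact: (eP (x, y)).
have cocycle i x y z : U i x -> U i y -> U i z -> (e x y * e y z)%g = e x z.
  move=> xi yi zi; have [p Up] := Uconn i _ _ xi yi.
  have [q Uq] := Uconn i _ _ yi zi.
  rewrite (eP _ _ _ _ Up) (eP _ _ _ _ Uq) -path_class_cat; apply/esym.
  exact: (eP _ _ _ _ (path_cat_in Up Uq)).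
have null s := @loop_null R X x0 N hN E T1 lX h hC (can_inj hK) hh n U Uopen
  Uconn UE Uhom r r0 e eP s.
have sub := @echain_cell X E n U UE.
apply: (finite_normal_generation (x0 := x0) eE chE Ucover Uopen UE cocycle hN).
(* [null] concerns loops at [x0]: a loop at [z] is conjugated by a cell chain [t] following [r z],
   and normality of [N] undoes the conjugation. *)
- move=> z s zs lz sz.
  have [t [xt lt et]] := path_cell_chain Ucover Uopen eP (r z).
  have zt : echain (cell_rel U) z (rev (belast x0 t)).
    by rewrite -lt; exact: (echain_rev (cell_rel_entourage Ucover Uopen)).
  have zt' : echain_homotopic E x0 (t ++ s ++ rev (belast x0 t)) [::].
    apply: echain_homotopic_trans (echain_homotopic_catV eE (sub _ _ xt)).
    apply: echain_homotopic_catl; first exact: sub.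
    rewrite lt; apply: (echain_homotopic_catr (t := [::])) sz.
    by rewrite lz; exact: sub.
  have wt : chain_prod e z (rev (belast x0 t)) = (chain_prod e x0 t)^-1%g.
    by rewrite -(chain_prod_rev cocycle xt) lt.
  have lt' : last z (rev (belast x0 t)) = x0 by rewrite -lt last_rev_belast.
  have : N (chain_prod e x0 (t ++ s ++ rev (belast x0 t))).
    apply/null => //; first by rewrite !echain_cat xt lt zs lz.
    by rewrite !last_cat lt lz.
  rewrite !chain_prod_cat lt lz wt mulgA.
  exact: (proj1 (normal_subgroup_conj hN _ _)).
(* A loop representing an element of [N] is replaced by a cell chain of the same class, which [null]
   shows to be [E]-null. *)
- move=> a; rewrite -[a]reprK; set p := repr a => Np.
  have [s [xs ls es]] := path_cell_chain Ucover Uopen eP p.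
  rewrite (path_class_loop _ r0) in es.
  by exists s; split=> //; apply/null => //; rewrite es.
Qed.
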